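(* Let $\eta=(e(X),\mu_0(X),\mu_1(X))$, and assume strong ignorability: $(Y^0,Y^1)\perp\!\!\!\perp A\mid X$ and $0<e(x)<1$ for all $x$. Suppose the propensity score $e(\cdot)$ is unknown. (a) If in addition monotonicity $Y^0\le Y^1$ holds (so that $\beta=1-\mu_0/\mu_1$), then the efficient influence function of $\beta$ is \begin{align*} \phi_\beta(Y,A,X;\eta)&=\frac{\mu_0}{\mu_1^2}A(Y-\mu_1(X))-\frac{1}{\mu_1}\frac{1-A}{1-e(X)}(Y-\mu_0(X))e(X)\\ &\quad+\frac{1}{\mu_1^2}[\mu_0\mu_1(X)-\mu_1\mu_0(X)](A-e(X))+\frac{1}{\mu_1^2}[\mu_0\mu_1(X)-\mu_1\mu_0(X)]e(X)\\ &=\frac{1-\beta}{\mu_1}AY-\frac{e(X)}{\mu_1}\frac{1-A}{1-e(X)}(Y-\mu_0(X))-\frac{\mu_0(X)}{\mu_1}A, \end{align*} and the associated semiparametric efficiency bound of $\beta$ is $\mathbb{V}(\phi_\beta(Y,A,X;\eta))=\mathbb{E}[\phi_\beta^2(Y,A,X;\eta)]$. (b) If instead in addition conditional independence $Y^0\perp\!\!\!\perp Y^1\mid X$ holds (so that $\beta=1-\mu/\mu_1$), then the efficient influence function of $\beta$ is \begin{align*} \varphi_\beta(Y,A,X;\eta)&=A\,\frac{\mu-\mu_1\mu_0(X)}{\mu_1^2}(Y-\mu_1(X))-\frac{e(X)}{\mu_1}\frac{1-A}{1-e(X)}(Y-\mu_0(X))\mu_1(X)\\ &\quad+\frac{\mu-\mu_1\mu_0(X)}{\mu_1^2}\mu_1(X)(A-e(X))+\frac{\mu-\mu_1\mu_0(X)}{\mu_1^2}\mu_1(X)e(X)\\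 &=A\,\frac{1-\beta-\mu_0(X)}{\mu_1}Y-\frac{e(X)}{\mu_1}\frac{1-A}{1-e(X)}(Y-\mu_0(X))\mu_1(X), \end{align*} and the associated semiparametric efficiency bound of $\beta$ is $\mathbb{V}(\varphi_\beta(Y,A,X;\eta))=\mathbb{E}[\varphi_\beta^2(Y,A,X;\eta)]$.
   Context: Setting: $X$ is a $p$-dimensional covariate vector, $A\in\{0,1\}$ a binary cause, $Y\in\{0,1\}$ a binary outcome, $Y^0,Y^1\in\{0,1\}$ the potential outcomes, with $Y=AY^1+(1-A)Y^0$. The propensity score is $e(x)=\mathbb{P}(A=1\mid X=x)$; the outcome regressions are $\mu_a(x)=\mathbb{P}(Y=1\mid X=x,A=a)$, $a=0,1$. Constants: $\mu_a=\mathbb{E}[\mu_a(X)e(X)]$ for $a=0,1$, and $\mu=\mathbb{E}[\mu_1(X)\mu_0(X)e(X)]$. The probability of necessary causation is $\beta=\mathbb{P}(Y^0=0\mid A=1,Y=1)$, where $\mathbb{P}(A=1,Y=1)>0$. $\mathbb{V}$ denotes variance. Efficient influence function: write $f_a(y\mid x)$ for the conditional density of $Y^a$ given $X=x$ and $f(x)$ for the density of $X$. The observed-data density of $(Y,A,X)$ is $[f_1(y\mid x)e(x)]^a[f_0(y\mid x)(1-e(x))]^{1-a}f(x)$. A regular parametric submodel indexes $f_1,f_0,e,f$ by a parameter $\theta$ (truth at $\theta_0$), with score $s(y,a,x;\theta)$; $\beta(\theta)$ is the identification formula for $\beta$ (stated in each part) evaluated at the submodel. The tangent space is $$\mathcal{T}=\{a\,s_1(y\mid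 x)+(1-a)s_0(y\mid x)+\alpha(x)(a-e(x))+s(x)\},$$ where $\int s_a(y\mid x)f_a(y\mid x)\,dy=0$ for $a=0,1$, $\int s(x)f(x)\,dx=0$, and $\alpha$ is an arbitrary square-integrable measurable function. An influence function of $\beta$ is a mean-zero function $\psi(Y,A,X)$ with $\partial\beta(\theta)/\partial\theta|_{\theta=\theta_0}=\mathbb{E}[\psi(Y,A,X)\,s(Y,A,X;\theta_0)]$ for every regular parametric submodel; the efficient influence function is the influence function belonging to $\mathcal{T}$, and the semiparametric efficiency bound is its variance. *)

(* Defs.v *)
From HB Require Import structures.
From mathcomp Require Export all_boot all_order all_algebra.
From mathcomp Require Export all_classical all_reals all_analysis.
Export Order.TTheory GRing.Theory Num.Theory.
Export numFieldNormedType.Exports.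

Set Implicit Arguments.
Unset Strict Implicit.
Unset Printing Implicit Defensive.

Local Open Scope classical_set_scope.
Local Open Scope ring_scope.

(* [cond_prob P Z E g]: g is a version of z |-> P(E | Z = z), that is,
   E[g(Z) 1{Z \in B}] = P(E, Z \in B) for every measurable B. *)
Definition cond_prob (d d' : measure_display) (Omega : measurableType d)
    (U : measurableType d') (R : realType) (P : probability Omega R)
    (Z : Omega -> U) (E : set Omega) (g : U -> R) : Prop :=
  [/\ measurable_fun [set: U] g,
      P.-integrable [set: Omega] (fun w => (g (Z w))%:E) &
      forall B : set U, measurable B ->
        (\int[P]_(w in Z @^-1` B) (g (Z w))%:E)%E = P (E `&` Z @^-1` B)].

(* V1 and V2 are conditionally independent given Z. *)
Definition cond_indep (d dZ d1 d2 : measure_display) (Omega : measurableType d)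
    (UZ : measurableType dZ) (U1 : measurableType d1) (U2 : measurableType d2)
    (R : realType) (P : probability Omega R)
    (Z : Omega -> UZ) (V1 : Omega -> U1) (V2 : Omega -> U2) : Prop :=
  forall (C1 : set U1) (C2 : set U2), measurable C1 -> measurable C2 ->
    exists g1 g2 : UZ -> R,
      [/\ cond_prob P Z (V1 @^-1` C1) g1,
          cond_prob P Z (V2 @^-1` C2) g2 &
          cond_prob P Z (V1 @^-1` C1 `&` V2 @^-1` C2)
            (fun z => g1 z * g2 z)].

(* The components of a law of the observed data: [cdens m a y x] is
   f_a(y | x), [prop m x] is e(x), and [xdens m x] is f(x).  Binary values
   are booleans, [true] standing for 1. *)
Record law (R : realType) (TX : Type) := Law {
  cdens : bool -> bool -> TX -> R;
  prop : TX -> R;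
  xdens : TX -> R }.

Definition obs_density (R : realType) (TX : Type) (m : law R TX)
    (y a : bool) (x : TX) : R :=
  (cdens m true y x * prop m x) ^+ a
  * (cdens m false y x * (1 - prop m x)) ^+ (~~ a)
  * xdens m x.

Section Model.
Context (d dX : measure_display) (Omega : measurableType d)
  (TX : measurableType dX) (R : realType).

(* f is a density of X with respect to the dominating measure nu. *)
Definition is_density (P : probability Omega R)
    (nu : {sigma_finite_measure set TX -> \bar R})
    (X : Omega -> TX) (f : TX -> R) : Prop :=
  [/\ measurable_fun [set: TX] f, forall x, 0 <= f x &
      forall B : set TX, measurable B ->
        P (X @^-1` B) = (\int[nu]_(x in B) (f x)%:E)%E].

Definition is_cond_density (P : probability Omega R) (X : Omega -> TX)
    (V : Omega -> bool) (f : bool -> TX -> R) : Prop :=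
  [/\ forall y x, 0 <= f y x,
      forall x, f false x + f true x = 1 &
      forall y, cond_prob P X (V @^-1` [set y]) (f y)].

Definition is_true_law (P : probability Omega R)
    (nu : {sigma_finite_measure set TX -> \bar R})
    (X : Omega -> TX) (A Y0 Y1 : Omega -> bool) (m : law R TX) : Prop :=
  [/\ is_cond_density P X Y1 (cdens m true),
      is_cond_density P X Y0 (cdens m false),
      cond_prob P X (A @^-1` [set true]) (prop m) &
      is_density P nu X (xdens m)].

(* The statistical model: nothing is restricted but overlap.  In particular
   the propensity score is unknown, and the restrictions linking Y^0 and Y^1
   enter only through the identification formula. *)
Definition model_law (nu : {sigma_finite_measure set TX -> \bar R})
    (m : law R TX) : Prop :=
  [/\ [/\ forall a y, measurable_fun [set: TX] (cdens m a y),
          forall a y x, 0 <= cdens m a y x &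
          forall a x, cdens m a false x + cdens m a true x = 1],
      measurable_fun [set: TX] (prop m) /\ (forall x, 0 < prop m x < 1) &
      [/\ measurable_fun [set: TX] (xdens m), forall x, 0 <= xdens m x &
          (\int[nu]_x (xdens m x)%:E)%E = 1%E]].

(* The identification formulas as functionals of the law: E[mu_a(X) e(X)]
   and E[mu_1(X) mu_0(X) e(X)] with mu_a(x) = f_a(1 | x). *)
Definition mu_law (nu : {sigma_finite_measure set TX -> \bar R})
    (m : law R TX) (a : bool) : R :=
  \int[nu]_x (cdens m a true x * prop m x * xdens m x).

Definition mu10_law (nu : {sigma_finite_measure set TX -> \bar R})
    (m : law R TX) : R :=
  \int[nu]_x (cdens m true true x * cdens m false true x
              * prop m x * xdens m x).

Definition beta_mono (nu : {sigma_finite_measure set TX -> \bar R})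
    (m : law R TX) : R := 1 - mu_law nu m false / mu_law nu m true.

Definition beta_ci (nu : {sigma_finite_measure set TX -> \bar R})
    (m : law R TX) : R := 1 - mu10_law nu m / mu_law nu m true.

Definition partial (k : nat) (F : 'rV[R]_k -> R) (j : 'I_k) (th : 'rV[R]_k) :
  R := 'D_(delta_mx ord0 j) F th.

(* j-th component of d/dtheta log p_theta(y,a,x).  Since x / 0 = 0, it is 0
   where p_theta(y,a,x) = 0. *)
Definition score (k : nat) (M : 'rV[R]_k -> law R TX) (th : 'rV[R]_k)
    (j : 'I_k) (y a : bool) (x : TX) : R :=
  partial (fun t => obs_density (M t) y a x) j th / obs_density (M th) y a x.

(* The coefficient alpha of a - e(x) in the j-th score. *)
Definition prop_score (k : nat) (M : 'rV[R]_k -> law R TX) (th : 'rV[R]_k)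
    (j : 'I_k) (x : TX) : R :=
  partial (fun t => prop (M t) x) j th
  / (prop (M th) x * (1 - prop (M th) x)).

(* Partial derivatives at th exist and, on the scale of the densities of
   (Y^a, X), (A, X) and X, are dominated by g. *)
Definition dominated_partials (k : nat) (M : 'rV[R]_k -> law R TX)
    (g : TX -> R) (th : 'rV[R]_k) : Prop :=
  forall (j : 'I_k) (x : TX),
  [/\ forall a y : bool,
        derivable (fun t => cdens (M t) a y x) th (delta_mx ord0 j) /\
        `|partial (fun t => cdens (M t) a y x) j th| * xdens (M th) x <= g x,
      derivable (fun t => prop (M t) x) th (delta_mx ord0 j) /\
        `|partial (fun t => prop (M t) x) j th| * xdens (M th) x <= g x &
      derivable (fun t => xdens (M t) x) th (delta_mx ord0 j) /\
        `|partial (fun t => xdens (M t) x) j th| <= g x].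

(* A k-dimensional submodel through m0 at th0 satisfying the classical
   (Cramer-type) regularity conditions: the component densities are
   differentiable near th0 with integrably dominated derivatives, the Fisher
   information at th0 is finite, and the alpha-component of the score is
   square integrable, as in the tangent space below.  Nonsingularity of the
   information matrix is not required. *)
Definition regular_submodel (P : probability Omega R)
    (nu : {sigma_finite_measure set TX -> \bar R})
    (Y A : Omega -> bool) (X : Omega -> TX) (m0 : law R TX)
    (k : nat) (th0 : 'rV[R]_k) (M : 'rV[R]_k -> law R TX) : Prop :=
  [/\ M th0 = m0,
      \forall th \near th0, model_law nu (M th),
      exists2 g : TX -> R,
        nu.-integrable [set: TX] (EFin \o g) &
        \forall th \near th0, dominated_partials M g th,
      forall j : 'I_k, P.-integrable [set: Omega]
        (fun w => (score M th0 j (Y w) (A w) (X w) ^+ 2)%:E) &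
      forall j : 'I_k, nu.-integrable [set: TX]
        (fun x => (prop_score M th0 j x ^+ 2 * xdens m0 x)%:E)].

(* The condition on s_1 and s_0 holds for almost every x, conditional
   densities being determined only up to null sets of the law of X. *)
Definition tangent_space (P : probability Omega R)
    (nu : {sigma_finite_measure set TX -> \bar R}) (X : Omega -> TX)
    (m0 : law R TX) (psi : bool -> bool -> TX -> R) : Prop :=
  exists (s1 s0 : bool -> TX -> R) (alpha s : TX -> R),
  [/\ forall y, measurable_fun [set: TX] (s1 y) /\
                measurable_fun [set: TX] (s0 y),
      {ae P, forall w,
         \sum_(y : bool) s1 y (X w) * cdens m0 true y (X w) = 0 /\
         \sum_(y : bool) s0 y (X w) * cdens m0 false y (X w) = 0},
      [/\ measurable_fun [set: TX] s,
          nu.-integrable [set: TX] (fun x => (s x * xdens m0 x)%:E) &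
          (\int[nu]_x (s x * xdens m0 x)%:E)%E = 0%E],
      measurable_fun [set: TX] alpha /\
      nu.-integrable [set: TX] (fun x => (alpha x ^+ 2 * xdens m0 x)%:E) &
      forall y a x,
        psi y a x = a%:R * s1 y x + (1 - a%:R) * s0 y x
                    + alpha x * (a%:R - prop m0 x) + s x].

Definition influence_function (P : probability Omega R)
    (nu : {sigma_finite_measure set TX -> \bar R})
    (Y A : Omega -> bool) (X : Omega -> TX) (m0 : law R TX)
    (beta : law R TX -> R) (psi : bool -> bool -> TX -> R) : Prop :=
  [/\ forall y a, measurable_fun [set: TX] (psi y a),
      P.-integrable [set: Omega] (fun w => (psi (Y w) (A w) (X w))%:E),
      ('E_P[fun w => psi (Y w) (A w) (X w)] = 0)%E &
      forall (k : nat) (th0 : 'rV[R]_k) (M : 'rV[R]_k -> law R TX),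
        regular_submodel P nu Y A X m0 th0 M ->
        forall j : 'I_k,
          P.-integrable [set: Omega]
            (fun w => (psi (Y w) (A w) (X w)
                       * score M th0 j (Y w) (A w) (X w))%:E) /\
          is_derive th0 (delta_mx ord0 j) (fun th => beta (M th))
            (fine 'E_P[(fun w => psi (Y w) (A w) (X w)
                        * score M th0 j (Y w) (A w) (X w))%R]%E)].

Definition efficient_influence_function (P : probability Omega R)
    (nu : {sigma_finite_measure set TX -> \bar R})
    (Y A : Omega -> bool) (X : Omega -> TX) (m0 : law R TX)
    (beta : law R TX -> R) (psi : bool -> bool -> TX -> R) : Prop :=
  influence_function P nu Y A X m0 beta psi /\ tangent_space P nu X m0 psi.

(* Extended-real valued: overlap alone does not force the bound to be
   finite. *)
Definition efficiency_bound (P : probability Omega R)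
    (nu : {sigma_finite_measure set TX -> \bar R})
    (Y A : Omega -> bool) (X : Omega -> TX) (m0 : law R TX)
    (beta : law R TX -> R) (v : \bar R) : Prop :=
  exists psi : bool -> bool -> TX -> R,
    efficient_influence_function P nu Y A X m0 beta psi /\
    v = 'V_P[fun w => psi (Y w) (A w) (X w)]%E.

Definition prob_necessary_causation (P : probability Omega R)
    (Y0 Y A : Omega -> bool) : R :=
  fine (P [set w | Y0 w = false /\ A w = true /\ Y w = true])
  / fine (P [set w | A w = true /\ Y w = true]).

(* In the two functions below, mu0 and mu1 (and mu) are the constants, and
   m0 and m1 the outcome regressions mu_0(.) and mu_1(.). *)
Definition phi_beta (mu0 mu1 : R) (e m0 m1 : TX -> R)
    (y a : bool) (x : TX) : R :=
  mu0 / mu1 ^+ 2 * a%:R * (y%:R - m1 x)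
  - 1 / mu1 * ((1 - a%:R) / (1 - e x)) * (y%:R - m0 x) * e x
  + 1 / mu1 ^+ 2 * (mu0 * m1 x - mu1 * m0 x) * (a%:R - e x)
  + 1 / mu1 ^+ 2 * (mu0 * m1 x - mu1 * m0 x) * e x.

Definition varphi_beta (mu mu1 : R) (e m0 m1 : TX -> R)
    (y a : bool) (x : TX) : R :=
  a%:R * ((mu - mu1 * m0 x) / mu1 ^+ 2) * (y%:R - m1 x)
  - e x / mu1 * ((1 - a%:R) / (1 - e x)) * (y%:R - m0 x) * m1 x
  + (mu - mu1 * m0 x) / mu1 ^+ 2 * m1 x * (a%:R - e x)
  + (mu - mu1 * m0 x) / mu1 ^+ 2 * m1 x * e x.

End Model.

(* Main.v *)
(** Both parts are one computation, for the functional
    [1 - E[mu_1(X)^r mu_0(X) e(X)] / E[mu_1(X) e(X)]] with [r = 0] under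
    monotonicity and [r = 1] under conditional independence.  Ignorability
    makes [obs_density] a density of [(Y, A, X)], and overlap then forces the
    outcome regressions to agree with the conditional densities of the
    potential outcomes wherever the density [f] of [X] does not vanish.  Along
    a coordinate line of a submodel, domination allows differentiation under
    the integral sign.  The score times the density is the derivative of the
    density (where the nonnegative density vanishes it is minimal, so its
    derivative vanishes too); hence [E[psi * score]] is the sum over [(y, a)]
    of the integrals of [psi * dp], and pointwise in [x] this sum is
    [(mur / mu1^2) d(mu_1 e f) - mu1^-1 d(mu_1^r mu_0 e f)], the integrand of
    the derivative of the functional.  The unbounded weight [e / (1 - e)] is
    controlled by the square integrability of the propensity component of the
    score. *)
From mathcomp Require Import measurable_realfun ring lra.
Require Import Defs.
Set Implicit Arguments.
Unset Strict Implicit.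
Unset Printing Implicit Defensive.
Local Open Scope classical_set_scope.
Local Open Scope ring_scope.

(** * Integration against a density *)

Section Density.
Context (d dT : measure_display) (Omega : measurableType d)
  (T : measurableType dT) (R : realType).
Variables (P : {measure set Omega -> \bar R}) (nu : {measure set T -> \bar R}).
Variables (X : Omega -> T) (E : set Omega) (q : T -> R).
Hypotheses (mX : measurable_fun [set: Omega] X) (mE : measurable E)
  (mq : measurable_fun [set: T] q) (q0 : forall x, 0 <= q x).
Hypothesis density : forall B, measurable B ->
  P (E `&` X @^-1` B) = (\int[nu]_(x in B) (q x)%:E)%E.

Import HBNNSimple.
Local Open Scope ereal_scope.

Let mpreX B : measurable B -> measurable (X @^-1` B).
Proof. by move=> mB; rewrite -[X in measurable X]setTI; exact: mX. Qed.

Let mqE : measurable_fun [set: T] (EFin \o q).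
Proof. exact/measurable_EFinP. Qed.

(** By linearity it suffices to treat the indicators of the level sets of [h], where the claim is
    the hypothesis [density]. *)
Let nnsfun_density (h : {nnsfun T >-> R}) :
  \int[P]_(w in E) (h (X w))%:E = \int[nu]_x ((h x)%:E * (q x)%:E).
Proof.
have indich r : measurable_fun [set: T] (fun x => (r * \1_(h @^-1` [set r]) x)%:E).
  by apply/measurable_EFinP; apply: measurable_funM.
transitivity (\int[P]_(w in E)
   (\sum_(y \in range h) (y * \1_(h @^-1` [set y]) (X w))%:E)).
  by apply: eq_integral => w wE; rewrite fimfunE -fsumEFin.
rewrite ge0_integral_fsum//; first last.
- by move=> n w Ew; rewrite EFinM; exact: (nnfun_muleindic_ge0 h n (X w)).
- move=> y; apply: (measurable_funS measurableT) => //.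
  exact: (measurableT_comp (indich y)).
transitivity (\int[nu]_x (\sum_(y \in range h)
    (y * \1_(h @^-1` [set y]) x)%:E * (q x)%:E)); last first.
  apply: eq_integral => x _.
  rewrite -ge0_mule_fsuml => [|y]; last by rewrite EFinM nnfun_muleindic_ge0.
  by rewrite fsumEFin // -(fimfunE _ x).
rewrite ge0_integral_fsum//; first last.
- by move=> n x _; rewrite mule_ge0 ?lee_fin// -lee_fin EFinM nnfun_muleindic_ge0.
- by move=> y; apply: emeasurable_funM.
apply: eq_fsbigr => r /set_mem[t _ rE].
have r0 : (0 <= r)%R by rewrite -rE.
have mr : measurable (h @^-1` [set r]) by [].
under eq_integral do rewrite EFinM.
rewrite ge0_integralZl//; first last.
- apply: (measurable_funS measurableT) => //.
  have -> : (fun x => (\1_(h @^-1` [set r]) (X x))%:E : \bar R) =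
     (EFin \o \1_(h @^-1` [set r])) \o X by [].
  by apply: measurableT_comp => //; exact/measurable_EFinP.
under [RHS]eq_integral do rewrite EFinM -muleA.
rewrite ge0_integralZl//; first last.
- by move=> x _; rewrite mule_ge0 ?lee_fin.
- by apply: emeasurable_funM => //; exact/measurable_EFinP.
congr (_ * _).
transitivity (P (E `&` X @^-1` (h @^-1` [set r]))).
  rewrite setIC -integral_indic//; last exact: mpreX.
rewrite density// integral_mkcond; apply: eq_integral => x _.
by rewrite epatch_indic muleC.
Qed.

(** Monotone convergence on both sides along simple functions increasing to [h]; nonnegativity of
    [q] keeps the weighted sequence increasing. *)
Lemma ge0_integral_density (h : T -> \bar R) :
  measurable_fun [set: T] h -> (forall x, 0 <= h x) ->
  \int[P]_(w in E) h (X w) = \int[nu]_x (h x * (q x)%:E).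
Proof.
move=> mh h0; pose h_ := nnsfun_approx measurableT mh.
have hE x : h x = limn (fun n => (h_ n x)%:E).
  by apply/esym/cvg_lim => //; apply: cvg_nnsfun_approx.
transitivity (limn (fun n => \int[P]_(w in E) (h_ n (X w))%:E)).
  rewrite -monotone_convergence//.
  - by apply: eq_integral => w _; rewrite hE.
  - move=> n; apply: (measurable_funS measurableT) => //.
    by apply/measurable_EFinP; apply: measurableT_comp.
  - by move=> n w _; rewrite lee_fin.
  - by move=> w _ m n mn; rewrite lee_fin; exact/lefP/nd_nnsfun_approx.
transitivity (limn (fun n => \int[nu]_x ((h_ n x)%:E * (q x)%:E))).
  by congr (limn _); apply/funext => n; exact: nnsfun_density.
rewrite -monotone_convergence//.
- apply: eq_integral => x _; apply/cvg_lim => //.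
  by apply: cvgeZr => //; apply: cvg_nnsfun_approx.
- move=> n; apply: emeasurable_funM => //.
  exact/measurable_EFinP.
- by move=> n w _; rewrite mule_ge0// lee_fin.
- move=> w _ m n mn; rewrite lee_wpmul2r ?lee_fin//.
  exact/lefP/nd_nnsfun_approx.
Qed.

Lemma integrable_density (h : T -> R) : measurable_fun [set: T] h ->
  P.-integrable E (EFin \o h \o X) <->
  nu.-integrable [set: T] (fun x => (h x * q x)%:E).
Proof.
move=> mh.
have e : \int[P]_(w in E) `|(h (X w))%:E| = \int[nu]_x `|(h x * q x)%:E|.
  rewrite (ge0_integral_density (h := fun x => `|(h x)%:E|))//.
    by apply: eq_integral => x _; rewrite EFinM abseM (@gee0_abs _ (q x)%:E) ?lee_fin.
  by apply: measurableT_comp => //; exact/measurable_EFinP.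
split=> /integrableP[_ h1]; apply/integrableP; split.
- by apply/measurable_EFinP; apply: measurable_funM.
- by rewrite -e.
- apply: (measurable_funS measurableT) => //.
  by apply: measurableT_comp => //; exact/measurable_EFinP.
- by rewrite e.
Qed.

(** Since [q] is nonnegative, multiplying by it commutes with taking positive and negative parts,
    and the nonnegative case applies to each part. *)
Lemma integral_density (h : T -> R) : measurable_fun [set: T] h ->
  nu.-integrable [set: T] (fun x => (h x * q x)%:E) ->
  \int[P]_(w in E) (h (X w))%:E = \int[nu]_x (h x * q x)%:E.
Proof.
move=> mh ih.
have mhE : measurable_fun [set: T] (EFin \o h) by exact/measurable_EFinP.
have posE : (fun x => (h x * q x)%:E)^\+ = (fun x => (EFin \o h)^\+ x * (q x)%:E).
  apply/funext => x; rewrite !funeposE/=.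
  by rewrite -!EFin_max -EFinM maxr_pMl// mul0r.
have negE : (fun x => (h x * q x)%:E)^\- = (fun x => (EFin \o h)^\- x * (q x)%:E).
  apply/funext => x; rewrite !funenegE/=.
  by rewrite -!EFin_max -EFinM maxr_pMl// mul0r mulNr.
rewrite [LHS]integralE [RHS]integralE posE negE.
rewrite -(ge0_integral_density (h := (EFin \o h)^\+))//; last exact: measurable_funepos.
rewrite -(ge0_integral_density (h := (EFin \o h)^\-))//; last exact: measurable_funeneg.
by congr (_ - _); apply: eq_integral => w _; rewrite ?funeposE ?funenegE.
Qed.

End Density.

(** Inversion is continuous on the open complement of 0, and on the singleton {0} every function is
    measurable. *)
Lemma measurable_funV (d : measure_display) (T : measurableType d)
    (R : realType) (f : T -> R) : measurable_fun [set: T] f ->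
  measurable_fun [set: T] (fun x => (f x)^-1).
Proof.
move=> mf.
have mV : measurable_fun [set: R] (fun y : R => y^-1).
  have oD : open (~` [set 0 : R]) by apply: closed_openC; exact: closed_eq.
  rewrite -(setvU [set 0 : R]); apply/measurable_funU => //.
    exact: measurableC.
  split; last exact: measurable_fun_set1.
  apply: open_continuous_measurable_fun => // x; rewrite inE => /eqP x0.
  exact: inv_continuous.
exact: (measurableT_comp mV mf).
Qed.

Section FinitePartition.
Context (d : measure_display) (T : measurableType d) (R : realType)
  (mu : {measure set T -> \bar R}) (I : finType) (V : T -> I) (f : T -> R).
Hypotheses (mV : forall i, measurable (V @^-1` [set i]))
  (f_int : forall i, mu.-integrable (V @^-1` [set i]) (EFin \o f)).

Let fE : EFin \o f = fun x => (\sum_i ((EFin \o f) \_ (V @^-1` [set i])) x)%E.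
Proof.
apply/funext => x; rewrite (bigD1 (V x))//= big1 ?adde0.
  by rewrite patchE mem_set.
by move=> i iV; rewrite patchE memNset//= => Vx; rewrite Vx eqxx in iV.
Qed.

Let int_patch i : mu.-integrable [set: T] ((EFin \o f) \_ (V @^-1` [set i])).
Proof. by rewrite -integrable_mkcond. Qed.

(** The fibres of [V] are finitely many and partition [T], so [f] is the finite sum of its
    restrictions to them. *)
Lemma integrable_partition : mu.-integrable [set: T] (EFin \o f).
Proof. by rewrite fE; apply: integrable_sum. Qed.

Lemma integral_partition : (\int[mu]_x (f x)%:E =
  \sum_i \int[mu]_(x in V @^-1` [set i]) (f x)%:E)%E.
Proof.
transitivity (\int[mu]_x (\sum_i ((EFin \o f) \_ (V @^-1` [set i])) x)%E)%E.
  by rewrite -fE.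
rewrite integral_sum//; apply: eq_bigr => i _.
by rewrite [RHS]integral_mkcond.
Qed.

End FinitePartition.

Lemma integrable_ae_eq (d : measure_display) (T : measurableType d)
    (R : realType) (mu : {measure set T -> \bar R}) (f g : T -> \bar R) :
  measurable_fun [set: T] g -> ae_eq mu [set: T] f g ->
  mu.-integrable [set: T] f -> mu.-integrable [set: T] g.
Proof.
move=> mg fg /integrableP[mf fi]; apply/integrableP; split => //.
rewrite -(@ae_eq_integral _ _ _ _ _ (abse \o g) (abse \o f)) //.
- exact: measurableT_comp.
- exact: measurableT_comp.
- exact: ae_eq_abse.
Qed.

(** * Differentiation under the integral sign *)

Section DeriveLine.
Context (R : numFieldType) (V W : normedModType R) (F : V -> W) (a v : V).

Let line_quotient (h : R) :
  (fun k : R => k^-1 *: (((fun t : R => F (a + t *: v)) \o shift h) (k *: 1)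
       - F (a + h *: v))) =
  (fun k : R => k^-1 *: ((F \o shift (a + h *: v)) (k *: v) - F (a + h *: v))).
Proof.
apply/funext => k /=; congr (_ *: (F _ - _)).
by rewrite [k *: 1]mulr1 scalerDl addrCA.
Qed.

(** The directional difference quotient of [F] is the ordinary one of its restriction to the line;
    this reduces partial derivatives in a submodel to calculus in one real variable. *)
Lemma derivable_line (h : R) :
  derivable (fun t : R => F (a + t *: v)) h 1 = derivable F (a + h *: v) v.
Proof. by rewrite /derivable line_quotient. Qed.

Lemma derive_line (h : R) :
  'D_1 (fun t : R => F (a + t *: v)) h = 'D_v F (a + h *: v).
Proof. by rewrite /derive line_quotient. Qed.

Lemma is_derive_line (df : W) :
  is_derive (0 : R) 1 (fun t : R => F (a + t *: v)) df -> is_derive a v F df.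
Proof.
move: (derivable_line 0) (derive_line 0); rewrite scale0r addr0 => E1 E2.
by case=> ? ?; apply: DeriveDef; rewrite -?E1 -?E2.
Qed.

End DeriveLine.

Lemma near0P (R : realFieldType) (Q : R -> Prop) :
  (\forall h \near (0 : R), Q h) <-> exists2 r : R, 0 < r & forall h, `|h| < r -> Q h.
Proof.
split.
  move=> /nbhs_ballP[r /= r0 rQ]; exists r => // h hr; apply: rQ.
  by rewrite /ball/= sub0r normrN.
case=> r r0 rQ; apply/nbhs_ballP; exists r => // h.
by rewrite /ball/= sub0r normrN; exact: rQ.
Qed.

(** Fermat's rule: a nonnegative function vanishing at 0 has an interior minimum there. *)
Lemma derive_at_min0 (R : realType) (f : R -> R) :
  (\forall h \near (0 : R), 0 <= f h /\ derivable f h 1) -> f 0 = 0 -> 'D_1 f 0 = 0.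
Proof.
move=> /near0P[r r0 fr] f0.
apply: derive_val.
apply: (@derive1_at_min _ f (- r) r 0) => //.
- lra.
- by move=> t; rewrite in_itv /= => tr; apply: (fr t _).2; rewrite ltr_norml.
- by rewrite in_itv/=; apply/andP; split; lra.
- move=> t; rewrite in_itv /= => tr; rewrite f0; apply: (fr t _).1.
  by rewrite ltr_norml.
Qed.

Section Differentiation.
Context (d : measure_display) (T : measurableType d) (R : realType)
  (mu : {measure set T -> \bar R}) (F : R -> T -> R).

(** The derivative is the pointwise limit of measurable difference quotients along a sequence of
    steps tending to 0. *)
Lemma measurable_derive :
  (\forall h \near (0 : R), measurable_fun [set: T] (F h)) ->
  (forall x, derivable (F ^~ x) 0 1) ->
  measurable_fun [set: T] (fun x => 'D_1 (F ^~ x) 0).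
Proof.
move=> /near0P[r r0 mF] dF.
(* The shift by 2 makes every step strictly smaller than [r], including the first. *)
pose u (n : nat) := r / n.+2%:R.
have u0 n : u n != 0 by rewrite mulf_neq0 ?gt_eqF// invr_gt0.
have ur n : `|u n| < r.
  rewrite ger0_norm ?divr_ge0 ?ltW// /u ltr_pdivrMr// -[ltLHS]mulr1.
  by rewrite ltr_pM2l// ltr1n.
have cu : u n @[n --> \oo] --> (0 : R).
  rewrite -[0 in X in _ --> X](mulr0 r); apply: cvgMl_tmp.
  by have := @cvg_harmonic R; rewrite -(cvg_shiftS (@harmonic R)).
apply: (@measurable_fun_cvg _ _ _ _ (fun n x => (u n)^-1 * (F (u n) x - F 0 x))).
  move=> n; apply: measurable_funM => //; apply: measurable_funB.
    exact: mF.
  by apply: mF; rewrite normr0.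
move=> x _; have /cvgr_dnbhsP/(_ u) := dF x; rewrite -/(derive _ _ _).
have -> : (fun n => (u n)^-1 * (F (u n) x - F 0 x)) =
  ((fun h : R => h^-1 *: ((F ^~ x \o shift 0) (h *: 1) - F 0 x)) \o u).
  by apply/funext => n /=; rewrite addr0 [_ *: 1]mulr1.
by apply; split.
Qed.

(** Dominated convergence on an interval around 0 where both neighbourhood hypotheses hold; the
    integrability of the derivative comes from the same bound [G]. *)
Lemma is_derive_integral (G : T -> R) :
  (\forall h \near (0 : R), mu.-integrable [set: T] (EFin \o F h)) ->
  mu.-integrable [set: T] (EFin \o G) ->
  (\forall h \near (0 : R), forall x,
    derivable (F ^~ x) h 1 /\ `|'D_1 (F ^~ x) h| <= G x) ->
  mu.-integrable [set: T] (fun x => ('D_1 (F ^~ x) 0)%:E) /\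
  is_derive (0 : R) 1 (fun h => \int[mu]_x F h x) (\int[mu]_x 'D_1 (F ^~ x) 0).
Proof.
move=> iF iG dF; split.
  apply: (le_integrable _ _ _ iG) => //.
    apply/measurable_EFinP; apply: measurable_derive.
      by apply: filterS iF => h /measurable_int/measurable_EFinP.
    by move=> x; have /(_ x)[] := nbhs_singleton dF.
  move=> x _; rewrite lee_fin; have /(_ x)[_ h] := nbhs_singleton dF.
  exact: le_trans h (ler_norm _).
have /near0P[r r0 rF] : \forall h \near (0 : R),
    mu.-integrable [set: T] (EFin \o F h) /\
    forall x, derivable (F ^~ x) h 1 /\ `|'D_1 (F ^~ x) h| <= G x.
  by apply: filterS2 iF dF.
have I h : `]- r, r[%classic h -> `|h| < r.
  by rewrite /= in_itv/= ltr_norml.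
have H0 : `]- r, r[%classic (0 : R) by rewrite /= in_itv/= oppr_lt0 r0.
have cF := @cvg_differentiation_under_integral _ _ _ mu F _ measurableT 0 (- r) r
  H0 (fun h hI => (rF h (I h hI)).1)
  (fun h x hI _ => ((rF h (I h hI)).2 x).1) G _ iG.
have G_ge0 x : 0 <= G x by exact: le_trans (normr_ge0 _) ((rF 0 (I _ H0)).2 x).2.
have G_ub h x : `]- r, r[%classic h -> [set: T] x -> `|partial1of2 F h x| <= G x.
  by move=> hI _; rewrite partial1of2E; exact: ((rF h (I h hI)).2 x).2.
have {}cF := cF G_ge0 G_ub.
have DE : \int[mu]_x partial1of2 F 0 x = \int[mu]_x 'D_1 (F ^~ x) 0.
  by apply: eq_Rintegral => x _; rewrite partial1of2E.
rewrite DE in cF.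
have E : (fun h : R => h^-1 *: (((fun h : R => \int[mu]_x F h x) \o shift 0) (h *: 1)
     - \int[mu]_x F 0 x)) =
   (fun h : R => h^-1 *: (\int[mu]_y F (h + 0) y - \int[mu]_y F 0 y)).
  by apply/funext => h /=; rewrite [h *: 1]mulr1.
apply: DeriveDef; rewrite ?/derivable ?/derive E.
  by apply/cvg_ex; eexists; exact: cF.
exact/cvg_lim.
Qed.

End Differentiation.

(** * One-parameter families of laws *)

Lemma is_derive_prod4 (R : realType) (c1 c0 e f : R -> R) (h : R) :
  derivable c1 h 1 -> derivable c0 h 1 -> derivable e h 1 -> derivable f h 1 ->
  is_derive h 1 (fun t => c1 t * c0 t * e t * f t)
    ('D_1 c1 h * c0 h * e h * f h + c1 h * 'D_1 c0 h * e h * f h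
     + c1 h * c0 h * 'D_1 e h * f h + c1 h * c0 h * e h * 'D_1 f h).
Proof.
move=> /derivableP d1 /derivableP d0 /derivableP de /derivableP df.
have := is_deriveM (is_deriveM (is_deriveM d1 d0) de) df.
by move=> H; apply: (is_derive_eq H); rewrite /GRing.scale/= !fctE; ring.
Qed.

(** In each of the four Leibniz terms the differentiated factor, weighted by [f] unless it is [df]
    itself, is at most [g], and the remaining factors lie in [0, 1]. *)
Lemma prod4_derive_bound (R : realDomainType) (c1 c0 e f d1 d0 de df g : R) :
  0 <= c1 <= 1 -> 0 <= c0 <= 1 -> 0 <= e <= 1 -> 0 <= f ->
  `|d1| * f <= g -> `|d0| * f <= g -> `|de| * f <= g -> `|df| <= g ->
  `|d1 * c0 * e * f + c1 * d0 * e * f + c1 * c0 * de * f + c1 * c0 * e * df|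
    <= 4 * g.
Proof.
move=> /andP[c10 c11] /andP[c00 c01] /andP[e0 e1] f0 b1 b0 be bf.
have g0 : 0 <= g := le_trans (normr_ge0 _) bf.
have bound (u v : R) : 0 <= u -> u <= 1 -> `|v| <= g -> `|u * v| <= g.
  move=> u0 u1 vg; rewrite normrM (ger0_norm u0).
  by apply: le_trans vg; rewrite ler_piMl.
have absf (u : R) : `|u| * f = `|u * f| by rewrite normrM (ger0_norm f0).
rewrite !absf in b1 b0 be.
have -> : d1 * c0 * e * f + c1 * d0 * e * f + c1 * c0 * de * f + c1 * c0 * e * df
  = (c0 * e) * (d1 * f) + (c1 * e) * (d0 * f) + (c1 * c0) * (de * f)
    + (c1 * c0 * e) * df by ring.
rewrite (_ : 4 * g = g + g + g + g); last by ring.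
do 3! (apply: le_trans (ler_normD _ _) _; apply: lerD;
  last by apply: bound => //; rewrite ?mulr_ge0 ?mulr_ile1 ?mulr_ge0).
by apply: bound => //; rewrite ?mulr_ge0 ?mulr_ile1.
Qed.

(* The term [e * De / (1 - e)], with [De / (e * (1 - e))] the propensity
   component of the score, is where square integrability enters. *)
Lemma eif_derive_bound (R : realFieldType) (r y a : bool)
    (mur mu1 e m0 m1 c f Dc De Df g : R) :
  mu1 != 0 -> 0 < e < 1 -> 0 <= m0 <= 1 -> 0 <= m1 <= 1 -> 0 <= c <= 1 ->
  0 <= f -> `|Dc| * f <= g -> `|De| * f <= g -> `|Df| <= g ->
  `|(a%:R * (mur / mu1 ^+ 2 * y%:R - m0 * (if r then y%:R else 1) / mu1)
     - e / mu1 * ((1 - a%:R) / (1 - e)) * (y%:R - m0) * (if r then m1 else 1))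
    * (Dc * (if a then e else 1 - e) * f + c * (if a then De else - De) * f
       + c * (if a then e else 1 - e) * Df)|
  <= (`|mur / mu1 ^+ 2| + `|mu1^-1|)
     * (4 * g + f + (De / (e * (1 - e))) ^+ 2 * f).
Proof.
move=> mu1_neq0 /andP[e0 e1] /andP[m00 m01] /andP[m10 m11] /andP[c0 c1] f0 bc be bf.
set C : R := `|mur / _| + _; set ps := De / _.
have C0 : 0 <= C by rewrite addr_ge0.
have g0 : 0 <= g := le_trans (normr_ge0 _) bf.
have p0 : 0 <= ps ^+ 2 * f by rewrite mulr_ge0 ?sqr_ge0.
have s01 (b : bool) (u : R) : 0 <= u <= 1 -> 0 <= (if b then u else 1) <= 1.
  by case: b => //; rewrite ler01 lexx.
have y01 : 0 <= (y%:R : R) <= 1 by case: y; rewrite /= ?ler01 ?lexx.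
have prod_le1 (u v : R) : `|u| <= 1 -> `|v| <= 1 -> `|u * v| <= 1.
  by move=> u1 v1; rewrite normrM mulr_ile1.
have norm01 (u : R) : 0 <= u <= 1 -> `|u| <= 1.
  by move=> /andP[u0 u1]; rewrite ger0_norm.
have absf (u : R) : `|u| * f = `|u * f|.
  by rewrite normrM (ger0_norm f0).
rewrite normrM.
case: a => /=.
  (* For a = 1 no inverse weight occurs: the weight is bounded by [C], and the derivative is that of
     a fourfold product with one factor constantly 1. *)
  apply: ler_pM => //; last first.
    have h0 : `|(0 : R)| * f <= g by rewrite normr0 mul0r.
    have c01 : 0 <= c <= 1 by rewrite c0.
    have i01 : 0 <= (1 : R) <= 1 by rewrite ler01 lexx.
    have e01 : 0 <= e <= 1 by rewrite !ltW.
    have := prod4_derive_bound c01 i01 e01 f0 bc h0 be bf.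
    rewrite !(mulr0, mul0r, mulr1, addr0) => h4.
    by apply: le_trans h4 _; lra.
  rewrite subrr !mul0r mulr0 !mul0r subr0 mul1r.
  apply: le_trans (ler_normB _ _) _; apply: lerD.
    by rewrite normrM ler_piMr// norm01.
  rewrite normrM ler_piMl// prod_le1// norm01//; first by rewrite m00.
  exact: s01.
set s := (if r then m1 else 1).
have s1 : `|s| <= 1 by apply/norm01/s01; rewrite m10.
have ym : `|y%:R - m0| <= 1.
  by move/andP: y01 => [y0 y1]; rewrite ler_norml; apply/andP; split; lra.
have eu : e != 0 by rewrite gt_eqF.
have e1u : 1 - e != 0 by rewrite gt_eqF// subr_gt0.
have DeE : De = ps * (e * (1 - e)).
  by rewrite /ps divfK// mulf_neq0.
rewrite -normrM.
(* For a = 0 the factor 1 / (1 - e) cancels against 1 - e in the first and last terms; in the middle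
   one, De / (1 - e) equals [ps * e], which leaves a term linear in the propensity score
   component. *)
have -> : (0 * (mur / mu1 ^+ 2 * y%:R
        - m0 * (if r then y%:R else 1) / mu1) -
   e / mu1 * ((1 - 0) / (1 - e)) *
   (y%:R - m0) * s) *
  (Dc * (1 - e) * f +
   c * - De * f +
   c * (1 - e) * Df) =
  - (mu1^-1 * ((y%:R - m0) * s) *
   (e * (Dc * f)
    - (c * e ^+ 2) * (ps * f)
    + (c * e) * Df)).
  by rewrite DeE; field; rewrite mu1_neq0.
rewrite normrN normrM; apply: ler_pM => //.
  rewrite normrM; apply: (@le_trans _ _ `|mu1^-1|); last by rewrite lerDr.
  by rewrite ler_piMr// prod_le1.
have bound (u v b : R) : `|u| <= 1 -> `|v| <= b -> `|u * v| <= b.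
  move=> u1 vb; rewrite normrM; apply: le_trans vb.
  by rewrite ler_piMl.
have e_le1 : `|e| <= 1 by rewrite norm01// !ltW.
have c_le1 : `|c| <= 1 by rewrite norm01// c0.
have b1 : `|e * (Dc * f)| <= g.
  by apply: bound => //; rewrite -absf.
(* Only the square of [ps] is integrable against [f] by hypothesis, so the linear term is bounded
   through |ps| <= 1 + ps^2. *)
have b2 : `|c * e ^+ 2 * (ps * f)|
    <= f + ps ^+ 2 * f.
  apply: bound; first by rewrite prod_le1// expr2 prod_le1.
  rewrite -absf -[X in X + _]mul1r -mulrDl ler_wpM2r// -[ps ^+ 2]real_normK ?num_real//.
  by have := normr_ge0 (ps); nra.
have b3 : `|c * e * Df| <= g.
  by apply: bound => //; exact: prod_le1.
apply: le_trans (ler_normD _ _) _.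
apply: le_trans (lerD (ler_normB _ _) (lexx _)) _.
by lra.
Qed.

Lemma obs_densityE (R : realType) (T : Type) (m : law R T) (y a : bool) (x : T) :
  obs_density m y a x =
    cdens m a y x * (if a then prop m x else 1 - prop m x) * xdens m x.
Proof. by rewrite /obs_density; case: a; rewrite expr1 expr0 ?mulr1 ?mul1r. Qed.

Section Laws.
Context (d : measure_display) (T : measurableType d) (R : realType)
  (nu : {sigma_finite_measure set T -> \bar R}).

(* The exponents of mu_1(x) and mu_0(x) are encoded by booleans: (true, false),
   (false, true) and (true, true) integrate to mu_1, mu_0 and mu. *)
Definition factors (r1 r0 : bool) (m : law R T) (x : T) : R :=
  (if r1 then cdens m true true x else 1)
  * (if r0 then cdens m false true x else 1) * prop m x * xdens m x.

Lemma cdens_itv01 m a y x : model_law nu m -> 0 <= cdens m a y x <= 1.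
Proof.
case=> -[_ c0 c1] _ _; rewrite c0 /= -(c1 a x).
by case: y; rewrite ?lerDl ?lerDr.
Qed.

Lemma prop_itv01 m x : model_law nu m -> 0 <= prop m x <= 1.
Proof. by case=> _ [_ /(_ x)/andP[e0 e1]] _; rewrite !ltW. Qed.

Lemma integrable_xdens m : model_law nu m ->
  nu.-integrable [set: T] (EFin \o xdens m).
Proof.
case=> _ _ [mf f0 f1]; apply/integrableP; split; first exact/measurable_EFinP.
rewrite (_ : \int[nu]_x _ = 1)%E ?ltry// -f1; apply: eq_integral => x _ /=.
by rewrite ger0_norm.
Qed.

Lemma measurable_factors r1 r0 m : model_law nu m ->
  measurable_fun [set: T] (factors r1 r0 m).
Proof.
case=> -[mc _ _] [me _] [mf _ _].
apply: measurable_funM => //; apply: measurable_funM => //.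
by apply: measurable_funM; [case: r1|case: r0]; first [exact: mc|exact: measurable_cst].
Qed.

(** All factors other than the density of X lie in [0, 1], so that density dominates. *)
Lemma integrable_factors r1 r0 m : model_law nu m ->
  nu.-integrable [set: T] (EFin \o factors r1 r0 m).
Proof.
move=> Mm; apply: (le_integrable _ _ _ (integrable_xdens Mm)) => //.
  exact/measurable_EFinP/measurable_factors.
move=> x _; rewrite /= lee_fin /factors.
have /andP[a0 a1] := cdens_itv01 true true x Mm.
have /andP[b0 b1] := cdens_itv01 false true x Mm.
have /andP[e0 e1] := prop_itv01 x Mm.
have f0 : 0 <= xdens m x by case: Mm => _ _ [].
rewrite !normrM [ `|xdens m x|]ger0_norm// [ `|prop m x|]ger0_norm//.
rewrite ler_piMl// mulr_ile1// ?mulr_ge0// mulr_ile1//.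
- by case: r1; rewrite ?normr1 ?ger0_norm.
- by case: r0; rewrite ?normr1 ?ger0_norm.
Qed.

Lemma measurable_obs_density m y a : model_law nu m ->
  measurable_fun [set: T] (obs_density m y a).
Proof.
case=> -[mc _ _] [me _] [mf _ _].
rewrite (_ : obs_density m y a = fun x => cdens m a y x *
  (if a then prop m x else 1 - prop m x) * xdens m x); last first.
  by apply/funext => x; rewrite obs_densityE.
apply: measurable_funM => //; apply: measurable_funM => //.
by case: a => //; apply: measurable_funB.
Qed.

Lemma obs_density_ge0 m y a x : model_law nu m -> 0 <= obs_density m y a x.
Proof.
move=> mm; rewrite obs_densityE mulr_ge0//; last by case: mm => _ _ [].
have /andP[c0 _] := cdens_itv01 a y x mm.
have /andP[e0 e1] := prop_itv01 x mm.
by case: a c0 => c0; rewrite mulr_ge0 ?subr_ge0.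
Qed.

(* phi_beta for [r = false], varphi_beta for [r = true], in reduced form. *)
Definition eif (r : bool) (mur mu1 : R) (e m0 m1 : T -> R) (y a : bool) (x : T) : R :=
  a%:R * (mur / mu1 ^+ 2 * y%:R - m0 x * (if r then y%:R else 1) / mu1)
  - e x / mu1 * ((1 - a%:R) / (1 - e x)) * (y%:R - m0 x) * (if r then m1 x else 1).

Lemma measurable_eif (r : bool) (mur mu1 : R) (e m0 m1 : T -> R) (y a : bool) :
  measurable_fun [set: T] e ->
  measurable_fun [set: T] m0 -> measurable_fun [set: T] m1 ->
  measurable_fun [set: T] (eif r mur mu1 e m0 m1 y a).
Proof.
move=> me mm0 mm1.
have mV : measurable_fun [set: T] (fun x => (1 - e x)^-1).
  by apply: measurable_funV; exact: measurable_funB.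
apply: measurable_funB.
  apply: measurable_funM => //; apply: measurable_funB => //.
  by apply: measurable_funM => //; apply: measurable_funM.
apply: measurable_funM; last by case: r.
apply: measurable_funM; last by apply: measurable_funB.
apply: measurable_funM; first by apply: measurable_funM.
by apply: measurable_funM.
Qed.

End Laws.

(** * Differentiation along a dominated path of laws *)

Section Path.
Context (d : measure_display) (T : measurableType d) (R : realType)
  (nu : {sigma_finite_measure set T -> \bar R}) (L : R -> law R T) (g : T -> R).

(** The form taken by [dominated_partials] on a coordinate line, with one dominating function for
    all [h]. *)
Definition dominated_path (h : R) : Prop := forall x,
  [/\ forall a y, derivable (fun t => cdens (L t) a y x) h 1 /\
        `|'D_1 (fun t => cdens (L t) a y x) h| * xdens (L h) x <= g x,
      derivable (fun t => prop (L t) x) h 1 /\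
        `|'D_1 (fun t => prop (L t) x) h| * xdens (L h) x <= g x &
      derivable (fun t => xdens (L t) x) h 1 /\
        `|'D_1 (fun t => xdens (L t) x) h| <= g x].

Hypotheses (L_model : \forall h \near (0 : R), model_law nu (L h))
  (g_int : nu.-integrable [set: T] (EFin \o g))
  (L_dom : \forall h \near (0 : R), dominated_path h).

Let L_near : \forall h \near (0 : R), model_law nu (L h) /\ dominated_path h.
Proof. exact: filterS2 L_model L_dom. Qed.

Let L0_model : model_law nu (L 0) := nbhs_singleton L_model.
Let L0_dom : dominated_path 0 := nbhs_singleton L_dom.

Lemma is_derive_factors r1 r0 h x : dominated_path h ->
  let c1 t := if r1 then cdens (L t) true true x else 1 in
  let c0 t := if r0 then cdens (L t) false true x else 1 in
  let e t := prop (L t) x in let f t := xdens (L t) x in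
  is_derive h 1 (fun t => factors r1 r0 (L t) x)
    ('D_1 c1 h * c0 h * e h * f h + c1 h * 'D_1 c0 h * e h * f h
     + c1 h * c0 h * 'D_1 e h * f h + c1 h * c0 h * e h * 'D_1 f h).
Proof.
move=> /(_ x)[dc [de _] [df _]] /=; apply: is_derive_prod4 => //.
- by case: r1; [exact: (dc _ _).1|exact: derivable_cst].
- by case: r0; [exact: (dc _ _).1|exact: derivable_cst].
Qed.

Lemma derive_factors_bound r1 r0 h x : model_law nu (L h) -> dominated_path h ->
  derivable (fun t => factors r1 r0 (L t) x) h 1 /\
  `|'D_1 (fun t => factors r1 r0 (L t) x) h| <= 4 * g x.
Proof.
move=> mh dh; have [dF ->] := is_derive_factors r1 r0 x dh; split=> //.
have [dc [de be] [df bf]] := dh x.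
have g0 : 0 <= g x := le_trans (normr_ge0 _) bf.
have dcst (f : R) : `|'D_1 (cst 1 : R -> R) h| * f <= g x.
  by rewrite derive_cst normr0 mul0r.
clear dF; apply: prod4_derive_bound => //.
- by case: r1; rewrite ?(cdens_itv01 true true x mh)// ler01 lexx.
- by case: r0; rewrite ?(cdens_itv01 false true x mh)// ler01 lexx.
- exact: prop_itv01 mh.
- by case: mh => _ _ [].
- by case: r1; [exact: (dc _ _).2|exact: dcst].
- by case: r0; [exact: (dc _ _).2|exact: dcst].
Qed.

Lemma is_derive_integral_factors r1 r0 :
  nu.-integrable [set: T] (fun x => ('D_1 (fun t => factors r1 r0 (L t) x) 0)%:E) /\
  is_derive (0 : R) 1 (fun h => \int[nu]_x factors r1 r0 (L h) x)
    (\int[nu]_x 'D_1 (fun t => factors r1 r0 (L t) x) 0).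
Proof.
apply: (@is_derive_integral _ _ _ nu (fun t x => factors r1 r0 (L t) x)
          (fun x => 4 * g x)).
- by apply: filterS L_model => h; exact: integrable_factors.
- exact: (integrableZl measurableT 4 g_int).
- by apply: filterS2 L_model L_dom => h mh dh x; exact: derive_factors_bound.
Qed.

(** Near 0 the two values of the conditional density sum to 1, so their derivatives are opposite. *)
Lemma derive_cdens_false a x :
  'D_1 (fun t => cdens (L t) a false x) 0 = - 'D_1 (fun t => cdens (L t) a true x) 0.
Proof.
have [dc _ _] := L0_dom x.
rewrite (near_eq_derive (g := cst 1 - (fun t => cdens (L t) a true x))).
  by rewrite (derive_val (is_derive := is_deriveB (is_derive_cst (1 : R) (0 : R) 1)
    (derivableP (dc a true).1))) sub0r.
apply: filterS L_model => h [[_ _ c1] _ _].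
by rewrite !fctE -(c1 a x) addrK.
Qed.

Lemma is_derive_obs_density h y a x : dominated_path h ->
  let c t := cdens (L t) a y x in
  let ea t := if a then prop (L t) x else 1 - prop (L t) x in
  let de := 'D_1 (fun t => prop (L t) x) h in
  let f t := xdens (L t) x in
  is_derive h 1 (fun t => obs_density (L t) y a x)
    ('D_1 c h * ea h * f h + c h * (if a then de else - de) * f h
     + c h * ea h * 'D_1 f h).
Proof.
move=> /(_ x)[dc [de _] [df _]] /=.
have Dea : is_derive h 1 (fun t => if a then prop (L t) x else 1 - prop (L t) x)
    (if a then 'D_1 (fun t => prop (L t) x) h else - 'D_1 (fun t => prop (L t) x) h).
  case: a {dc} => /=; first exact: derivableP.
  have := is_deriveB (is_derive_cst (1 : R) h 1) (derivableP de).
  by move=> H; apply: (is_derive_eq H); rewrite sub0r.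
have [Da DaE] := Dea.
(* A constant factor 1 is inserted so that the fourfold product rule applies. *)
have -> : (fun t => obs_density (L t) y a x) = (fun t => cdens (L t) a y x * cst 1 t
    * (if a then prop (L t) x else 1 - prop (L t) x) * xdens (L t) x).
  by apply/funext => t; rewrite obs_densityE mulr1.
have D1 : derivable (cst 1 : R -> R) h 1 by exact: derivable_cst.
have H := is_derive_prod4 (dc a y).1 D1 Da df.
by apply: (is_derive_eq H); rewrite derive_cst DaE /cst /=; ring.
Qed.

(** Needed because the score is set to 0 where the density vanishes: no part of the derivative is
    then lost. *)
Lemma derive_obs_density_eq0 y a x : obs_density (L 0) y a x = 0 ->
  'D_1 (fun t => obs_density (L t) y a x) 0 = 0.
Proof.
move=> q0; apply: derive_at_min0 => //.
apply: filterS L_near => h [mh dh]; split; last first.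
  by have [] := is_derive_obs_density y a x dh.
exact: obs_density_ge0 mh.
Qed.

Lemma measurable_derive_obs_density y a :
  measurable_fun [set: T] (fun x => 'D_1 (fun t => obs_density (L t) y a x) 0).
Proof.
apply: (@measurable_derive _ _ _ (fun t x => obs_density (L t) y a x)).
  by apply: filterS L_model => h; exact: measurable_obs_density.
by move=> x; have [] := is_derive_obs_density y a x L0_dom.
Qed.

Section Weights.
Variables (r : bool) (mur mu1 : R).
Hypothesis mu1_neq0 : mu1 != 0.

Let w := eif r mur mu1 (prop (L 0)) (cdens (L 0) false true) (cdens (L 0) true true).

(* The nuisance directions cancel in this sum. *)
Lemma eif_derive_sum x :
  \sum_(i : bool * bool) w i.1 i.2 x * 'D_1 (fun t => obs_density (L t) i.1 i.2 x) 0
  = mur / mu1 ^+ 2 * 'D_1 (fun t => factors true false (L t) x) 0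
    - mu1^-1 * 'D_1 (fun t => factors r true (L t) x) 0.
Proof.
rewrite -(pair_bigA _ (fun y a => w y a x * 'D_1 (fun t => obs_density (L t) y a x) 0)).
rewrite !big_bool /=.
have D y a := derive_val (is_derive := is_derive_obs_density y a x L0_dom).
have DF r1 r0 := derive_val (is_derive := is_derive_factors r1 r0 x L0_dom).
rewrite !D !DF /= !derive_cdens_false derive_cst /w /eif.
have [[_ _ c1] [_ /(_ x) /andP[e0 e1]] _] := L0_model.
have cF a : cdens (L 0) a false x = 1 - cdens (L 0) a true x.
  by rewrite -(c1 a x) addrK.
rewrite !cF; have e1' : 1 - prop (L 0) x != 0 by rewrite gt_eqF// subr_gt0.
by case: r; rewrite ?derive_cst /=; field; rewrite mu1_neq0 e1'.
Qed.

Lemma integrable_eif_derive y a :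
  nu.-integrable [set: T] (fun x =>
    (('D_1 (fun t => prop (L t) x) 0 / (prop (L 0) x * (1 - prop (L 0) x))) ^+ 2
     * xdens (L 0) x)%:E) ->
  nu.-integrable [set: T]
    (fun x => (w y a x * 'D_1 (fun t => obs_density (L t) y a x) 0)%:E).
Proof.
move=> ps_int.
pose ps x : R := 'D_1 (fun t => prop (L t) x) 0 / (prop (L 0) x * (1 - prop (L 0) x)).
pose C : R := `|mur / mu1 ^+ 2| + `|mu1^-1|.
(* The right-hand side of [eif_derive_bound], each term of which is integrable. *)
pose G x : R := C * (4 * g x + xdens (L 0) x + ps x ^+ 2 * xdens (L 0) x).
have G_int : nu.-integrable [set: T] (EFin \o G).
  have i1 := integrableZl measurableT 4 g_int.
  have i2 := integrableD measurableT i1 (integrable_xdens L0_model).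
  have i3 := integrableD measurableT i2 ps_int.
  exact: (integrableZl measurableT C i3).
apply: (le_integrable _ _ _ G_int) => //.
  apply/measurable_EFinP/measurable_funM; last exact: measurable_derive_obs_density.
  by case: L0_model => -[mc _ _] [me _] _; apply: measurable_eif.
move=> x _; rewrite lee_fin.
have [dc [de be] [df bf]] := L0_dom x.
rewrite (derive_val (is_derive := is_derive_obs_density y a x L0_dom)).
apply: le_trans (ler_norm _); apply: eif_derive_bound => //.
- by case: L0_model => _ [].
- exact: cdens_itv01 L0_model.
- exact: cdens_itv01 L0_model.
- exact: cdens_itv01 L0_model.
- by case: L0_model => _ _ [].
- exact: (dc a y).2.
Qed.

End Weights.
End Path.

(** * Densities of the law of X restricted to an event *)

Section HasDensity.
Context (d dT : measure_display) (Omega : measurableType d)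
  (T : measurableType dT) (R : realType) (P : probability Omega R)
  (nu : {sigma_finite_measure set T -> \bar R}) (X : Omega -> T).
Hypothesis mX : measurable_fun [set: Omega] X.

(** Replaces conditional probabilities by joint densities, which are unique up to [nu]-null sets and
    so can be compared without dividing by the density of X. *)
Definition has_density (E : set Omega) (q : T -> R) : Prop :=
  nu.-integrable [set: T] (EFin \o q) /\
  forall B, measurable B -> P (E `&` X @^-1` B) = (\int[nu]_(x in B) (q x)%:E)%E.

Let mpreX B : measurable B -> measurable (X @^-1` B).
Proof. by move=> mB; rewrite -[X in measurable X]setTI; exact: mX. Qed.

Lemma has_density_unique E q q' : has_density E q -> has_density E q' ->
  {ae nu, forall x, q x = q' x}.
Proof.
move=> [iq Eq] [iq' Eq'].
have /(filterS _) : ae_eq nu [set: T] (EFin \o q) (EFin \o q').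
  apply: integral_ae_eq => //; first exact: measurable_int iq'.
  by move=> B _ mB; rewrite -Eq// -Eq'.
by apply => x /(_ Logic.I) [].
Qed.

Lemma has_density_ae E q q' : has_density E q ->
  measurable_fun [set: T] q' -> {ae nu, forall x, q x = q' x} -> has_density E q'.
Proof.
move=> [iq Eq] mq' qq'.
have mq : measurable_fun [set: T] (EFin \o q) := measurable_int _ iq.
have mq'E : measurable_fun [set: T] (EFin \o q') by exact/measurable_EFinP.
have ae : ae_eq nu [set: T] (EFin \o q) (EFin \o q').
  by apply: filterS qq' => x + _ /= => ->.
split; first exact: integrable_ae_eq ae iq.
move=> B mB; rewrite Eq//; apply: ae_eq_integral => //.
- exact: measurable_funS mq.
- exact: measurable_funS mq'E.
- exact: ae_eq_subset ae.
Qed.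

Lemma integral_has_density E q (h : T -> R) B : measurable E ->
  (forall x, 0 <= q x) -> has_density E q -> measurable B ->
  measurable_fun [set: T] h ->
  nu.-integrable [set: T] (fun x => (h x * q x)%:E) ->
  (\int[P]_(w in E `&` X @^-1` B) (h (X w))%:E = \int[nu]_(x in B) (h x * q x)%:E)%E.
Proof.
move=> mE q0 [iq Eq] mB mh ih.
have mq : measurable_fun [set: T] q by apply/measurable_EFinP; exact: measurable_int iq.
rewrite integral_mkcondr [RHS]integral_mkcond.
(* The restriction to [B] is absorbed into the integrand, which leaves an integral over all of
   [E]. *)
transitivity (\int[P]_(w in E) ((h \* \1_B) (X w))%:E)%E.
  apply: eq_integral => w _; rewrite patchE /= indicE.
  have -> : (w \in X @^-1` B) = (X w \in B) by apply/idP/idP => /set_mem /mem_set.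
  by case: ifPn; rewrite ?mulr1 ?mulr0.
have mhB : measurable_fun [set: T] (h \* \1_B) by apply: measurable_funM.
have e x : (((h \* \1_B) x * q x)%:E = ((fun x => (h x * q x)%:E) \_ B) x)%E.
  by rewrite patchE /= indicE; case: ifPn; rewrite ?mulr1 ?mulr0 ?mul0r.
rewrite (integral_density (nu := nu) (q := q))//.
  by apply: eq_integral => x _; rewrite e.
rewrite (_ : (fun x => _) = (fun x => (h x * q x)%:E) \_ B); last exact/funext/e.
by rewrite -integrable_mkcond//; exact: integrableS ih.
Qed.

Variable f : T -> R.
Hypothesis f_density : is_density P nu X f.

Lemma is_density_has_density : has_density [set: Omega] f.
Proof.
have [mf f0 fE] := f_density; split; last by move=> B mB; rewrite setTI fE.
apply/integrableP; split; first exact/measurable_EFinP.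
under eq_integral do rewrite /= ger0_norm//.
by rewrite -fE// preimage_setT probability_setT ltry.
Qed.

Lemma cond_prob_has_density E g : cond_prob P X E g ->
  has_density E (fun x => g x * f x).
Proof.
have [mf f0 fE] := f_density; have [ifd fd] := is_density_has_density.
move=> [mg ig gE].
have ign : nu.-integrable [set: T] (fun x => (g x * f x)%:E).
  by apply/(integrable_density (P := P) (X := X) (E := setT)).
split=> // B mB; rewrite -gE// -[X @^-1` B in LHS]setTI.
by rewrite (integral_has_density (q := f)).
Qed.

Lemma has_densityC E q : measurable E -> has_density E q ->
  has_density (~` E) (fun x => f x - q x).
Proof.
move=> mE [iq Eq]; have [ifd fd] := is_density_has_density.
split; first exact: (integrableB measurableT ifd iq).
move=> B mB; under eq_integral do rewrite EFinB.
rewrite integralB//; [|exact: integrableS ifd|exact: integrableS iq].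
rewrite -Eq// -fd// setTI setIC -setDE measureD//; [|exact: mpreX|].
  by rewrite setIC.
by apply: (le_lt_trans (probability_le1 _ _)); rewrite ?ltry//; exact: mpreX.
Qed.

(** The versions g1, g2 supplied by conditional independence need not be k1, k2, but g1 f = k1 f and
    g2 f = k2 f almost everywhere. Hence g1 g2 f = g1 k2 f = k1 k2 f, again without division. *)
Lemma cond_indep_has_density (d1 d2 : measure_display) (U1 : measurableType d1)
    (U2 : measurableType d2) (V1 : Omega -> U1) (V2 : Omega -> U2)
    (C1 : set U1) (C2 : set U2) (k1 k2 : T -> R) :
  cond_indep P X V1 V2 -> measurable C1 -> measurable C2 ->
  has_density (V1 @^-1` C1) (fun x => k1 x * f x) ->
  has_density (V2 @^-1` C2) (fun x => k2 x * f x) ->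
  measurable_fun [set: T] (fun x => k1 x * k2 x * f x) ->
  has_density (V1 @^-1` C1 `&` V2 @^-1` C2) (fun x => k1 x * k2 x * f x).
Proof.
move=> ci mC1 mC2 h1 h2 mk.
have [g1 [g2 [/cond_prob_has_density c1 /cond_prob_has_density c2
  /cond_prob_has_density c12]]] := ci _ _ mC1 mC2.
apply: has_density_ae c12 mk _.
apply: filterS2 (has_density_unique c1 h1) (has_density_unique c2 h2) => x e1 e2.
by rewrite -mulrA e2 mulrCA e1; ring.
Qed.

End HasDensity.

(** * The efficient influence function *)

Section Influence.
Context (d dT : measure_display) (Omega : measurableType d)
  (T : measurableType dT) (R : realType) (P : probability Omega R)
  (nu : {sigma_finite_measure set T -> \bar R})
  (X : Omega -> T) (Y A : Omega -> bool) (l0 : law R T).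
Hypotheses (mX : measurable_fun [set: Omega] X)
  (mYA : forall y a, measurable [set w | Y w = y /\ A w = a])
  (l0_model : model_law nu l0)
  (X_density : is_density P nu X (xdens l0))
  (YA_density : forall y a,
    has_density P nu X [set w | Y w = y /\ A w = a] (obs_density l0 y a)).

(** X avoids almost surely both the zeros of its density and every [nu]-null set. *)
Lemma ae_of_density (Q : T -> Prop) :
  {ae nu, forall x, xdens l0 x = 0 \/ Q x} -> {ae P, forall w, Q (X w)}.
Proof.
have [mf f0 fE] := X_density.
move=> [N [mN N0 QN]].
pose Z := [set x | xdens l0 x = 0].
have mZ : measurable Z.
  have -> : Z = xdens l0 @^-1` [set 0] by [].
  by rewrite -[X in measurable X]setTI; exact: mf.
have mpreX B : measurable B -> measurable (X @^-1` B).
  by move=> mB; rewrite -[X in measurable X]setTI; exact: mX.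
apply: (@negligibleS _ _ _ _ (X @^-1` N `|` X @^-1` Z)).
  move=> w /= nQ; have [Zw|Zw] := pselect (Z (X w)); [by right|left].
  by apply: QN => /= -[].
apply: negligibleU; apply/negligibleP; try exact: mpreX.
  rewrite -[LHS]/(P (X @^-1` N)) fE// null_set_integral//.
  by apply/measurable_EFinP; exact: measurable_funS mf.
by rewrite -[LHS]/(P (X @^-1` Z)) fE// integral0_eq// => x /= ->.
Qed.

(** The sample space is partitioned by the four values of (Y, A); on each cell the integrand depends
    on X alone and the cell has a known density. *)
Lemma integral_obs (h : bool -> bool -> T -> R) :
  (forall y a, measurable_fun [set: T] (h y a)) ->
  (forall y a, nu.-integrable [set: T]
     (fun x => (h y a x * obs_density l0 y a x)%:E)) ->
  P.-integrable [set: Omega] (fun w => (h (Y w) (A w) (X w))%:E) /\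
  (\int[P]_w (h (Y w) (A w) (X w))%:E =
    (\sum_(i : bool * bool)
       \int[nu]_x (h i.1 i.2 x * obs_density l0 i.1 i.2 x))%:E)%E.
Proof.
move=> mh ih; pose V w := (Y w, A w).
have VE i : V @^-1` [set i] = [set w | Y w = i.1 /\ A w = i.2].
  by case: i => y a; apply/seteqP; split=> w; rewrite /= /V => -[-> ->].
have mV i : measurable (V @^-1` [set i]) by rewrite VE.
have q0 y a x : 0 <= obs_density l0 y a x := obs_density_ge0 y a x l0_model.
have mq y a := measurable_obs_density y a l0_model.
have hV i w : w \in V @^-1` [set i] -> (h (Y w) (A w) (X w)) = h i.1 i.2 (X w).
  by move/set_mem; rewrite VE => -[-> ->].
have f_int i : P.-integrable (V @^-1` [set i]) (EFin \o (fun w => h (Y w) (A w) (X w))).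
  apply: (eq_integrable _ (EFin \o h i.1 i.2 \o X)) => //.
    by move=> w wV; rewrite /= (hV _ _ wV).
  rewrite (integrable_density (nu := nu) (q := obs_density l0 i.1 i.2))//.
  by move=> B mB; rewrite VE; exact: (YA_density _ _).2.
split; first exact: integrable_partition f_int.
rewrite (integral_partition mV f_int) -sumEFin; apply: eq_bigr => i _.
rewrite (eq_integral (fun w => (h i.1 i.2 (X w))%:E)); last by move=> w wV; rewrite (hV _ _ wV).
rewrite (integral_density (nu := nu) (q := obs_density l0 i.1 i.2))//; last first.
  by move=> B mB; rewrite VE; exact: (YA_density _ _).2.
by rewrite fineK//; exact: integrable_fin_num.
Qed.

Variables (r : bool) (m : bool -> T -> R).
Hypotheses (mm : forall a, measurable_fun [set: T] (m a))
  (m_cdens : {ae nu, forall x, xdens l0 x = 0 \/ forall a, m a x = cdens l0 a true x}).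

Let mu1 : R := \int[nu]_x factors true false l0 x.
Let mur : R := \int[nu]_x factors r true l0 x.
Hypothesis mu1_neq0 : mu1 != 0.

(** [psi] is written with the given regressions, [w] with the conditional densities. The latter lie
    in [0, 1] at every point, so bounds are proved for [w] and transferred to [psi] almost
    everywhere. *)
Let psi := eif r mur mu1 (prop l0) (m false) (m true).
Let w := eif r mur mu1 (prop l0) (cdens l0 false true) (cdens l0 true true).

Let mpsi y a : measurable_fun [set: T] (psi y a).
Proof. by case: l0_model => _ [me _] _; exact: measurable_eif. Qed.

Let mw y a : measurable_fun [set: T] (w y a).
Proof. by case: l0_model => -[mc _ _] [me _] _; exact: measurable_eif. Qed.

Let obs0 y a x : xdens l0 x = 0 -> obs_density l0 y a x = 0.
Proof. by rewrite obs_densityE => ->; rewrite mulr0. Qed.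

Let psi_w (k : T -> R) y a : (forall x, xdens l0 x = 0 -> k x = 0) ->
  ae_eq nu [set: T] (fun x => (w y a x * k x)%:E) (fun x => (psi y a x * k x)%:E).
Proof.
move=> k0; apply: filterS m_cdens => x + _ => -[/k0 ->|mE]; first by rewrite !mulr0.
by rewrite /psi /w /eif !mE.
Qed.

Let integrable_w_obs y a :
  nu.-integrable [set: T] (fun x => (w y a x * obs_density l0 y a x)%:E).
Proof.
pose C : R := `|mur / mu1 ^+ 2| + `|mu1^-1|.
(* The 5 is [4 * g + f] from [eif_derive_bound] when g and f are both the density of X and the
   propensity term is 0. *)
have i1 : nu.-integrable [set: T] (EFin \o (fun x => C * (5 * xdens l0 x))).
  have i5 := integrableZl measurableT 5 (integrable_xdens l0_model).
  exact: (integrableZl measurableT C i5).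
apply: (le_integrable _ _ _ i1) => //.
  apply/measurable_EFinP/measurable_funM => //.
  exact: (measurable_obs_density y a l0_model).
move=> x _; rewrite lee_fin; apply: le_trans (ler_norm _).
have f0 : 0 <= xdens l0 x by case: l0_model => _ _ [].
(* the case of a pure change of scale of the density of X *)
have := @eif_derive_bound R r y a mur mu1 (prop l0 x) (cdens l0 false true x)
  (cdens l0 true true x) (cdens l0 a y x) (xdens l0 x) 0 0 (xdens l0 x) (xdens l0 x).
have [_ [_ e01] _] := l0_model.
rewrite (ger0_norm f0) normr0 mul0r => /(_ mu1_neq0 (e01 x) (cdens_itv01 _ _ _ l0_model)
  (cdens_itv01 _ _ _ l0_model) (cdens_itv01 _ _ _ l0_model) f0 f0 f0 (lexx _)).
rewrite oppr0 if_same obs_densityE !(mul0r, mulr0, add0r, expr0n, addr0)/= /w /eif.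
by move=> H; apply: (le_trans H); rewrite ler_wpM2l ?addr_ge0//; lra.
Qed.

(** Passes from [psi] to [w] and moves the sum inside the integral, where the pointwise identities
    for [w] apply. It serves with [k] the observed density and with [k] its derivative. *)
Let integrable_psi (k : bool -> bool -> T -> R) :
  (forall y a x, xdens l0 x = 0 -> k y a x = 0) ->
  (forall y a, measurable_fun [set: T] (k y a)) ->
  (forall y a, nu.-integrable [set: T] (fun x => (w y a x * k y a x)%:E)) ->
  (forall y a, nu.-integrable [set: T] (fun x => (psi y a x * k y a x)%:E)) /\
  \sum_(i : bool * bool) \int[nu]_x (psi i.1 i.2 x * k i.1 i.2 x) =
  \int[nu]_x \sum_(i : bool * bool) (w i.1 i.2 x * k i.1 i.2 x).
Proof.
move=> k0 mk ik.
have mpk y a : measurable_fun [set: T] (fun x => (psi y a x * k y a x)%:E).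
  by apply/measurable_EFinP/measurable_funM.
split=> [y a|]; first exact: integrable_ae_eq (psi_w y a (k0 y a)) (ik y a).
rewrite [RHS]/Rintegral.
under [in RHS]eq_integral do rewrite -sumEFin.
rewrite integral_sum//.
rewrite -sum_fine; last by move=> i _; exact: integrable_fin_num (ik _ _).
apply: eq_bigr => i _; congr fine; apply: ae_eq_integral => //.
- exact: measurable_int (ik _ _).
- exact/ae_eq_sym/psi_w/k0.
Qed.

(** The mean-zero property before integration: the right-hand side integrates to mur / mu1 - mur /
    mu1. *)
Lemma eif_obs_sum x :
  \sum_(i : bool * bool) w i.1 i.2 x * obs_density l0 i.1 i.2 x
  = mur / mu1 ^+ 2 * factors true false l0 x - mu1^-1 * factors r true l0 x.
Proof.
rewrite -(pair_bigA _ (fun y a => w y a x * obs_density l0 y a x)).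
rewrite !big_bool /= !obs_densityE /factors /w /eif.
have [[_ _ c1] [_ /(_ x) /andP[e0 e1]] _] := l0_model.
have cF a : cdens l0 a false x = 1 - cdens l0 a true x.
  by rewrite -(c1 a x) addrK.
rewrite !cF; have e1' : 1 - prop l0 x != 0 by rewrite gt_eqF// subr_gt0.
by case: r; rewrite /=; field; rewrite mu1_neq0 e1'.
Qed.

Let Rintegral_lin (a b : R) (f g : T -> R) :
  nu.-integrable [set: T] (EFin \o f) -> nu.-integrable [set: T] (EFin \o g) ->
  \int[nu]_x (a * f x - b * g x) = a * \int[nu]_x f x - b * \int[nu]_x g x.
Proof.
move=> i1 i2; rewrite RintegralB//; last 2 first.
- exact: (integrableZl measurableT a i1).
- exact: (integrableZl measurableT b i2).
by rewrite !RintegralZl.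
Qed.

Lemma integral_eif :
  P.-integrable [set: Omega] (fun w => (psi (Y w) (A w) (X w))%:E) /\
  (\int[P]_w (psi (Y w) (A w) (X w))%:E = 0)%E.
Proof.
have [ip pE] := integrable_psi obs0 (fun y a => measurable_obs_density y a l0_model)
  integrable_w_obs.
have [i1 ->] := integral_obs mpsi ip; split => //.
rewrite pE; under eq_Rintegral do rewrite eif_obs_sum.
rewrite Rintegral_lin; try exact: integrable_factors.
by rewrite -/mu1 -/mur; congr EFin; field.
Qed.

Lemma eif_submodel (k : nat) (th0 : 'rV[R]_k) (M : 'rV[R]_k -> law R T) :
  regular_submodel P nu Y A X l0 th0 M -> forall j : 'I_k,
  P.-integrable [set: Omega] (fun w =>
    (psi (Y w) (A w) (X w) * score M th0 j (Y w) (A w) (X w))%:E) /\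
  is_derive th0 (delta_mx ord0 j)
    (fun th => 1 - (\int[nu]_x factors r true (M th) x)
                   / (\int[nu]_x factors true false (M th) x))
    (fine (\int[P]_w
      (psi (Y w) (A w) (X w) * score M th0 j (Y w) (A w) (X w))%:E)).
Proof.
move=> [M0 Mm [g ig Mg] _ ps] j.
pose v : 'rV[R]_k := delta_mx ord0 j.
pose L (h : R) := M (th0 + h *: v).
(* Continuity of the coordinate line pulls the conditions near [th0] back to conditions near 0. *)
have cL : (fun h : R => th0 + h *: v) @ (0 : R) --> th0.
  rewrite -[X in _ --> X]addr0 -(scale0r v).
  by apply: cvgD; [exact: cvg_cst|apply: cvgZ; [exact: cvg_id|exact: cvg_cst]].
have L0 : L 0 = l0 by rewrite /L scale0r addr0.
have L_model : \forall h \near (0 : R), model_law nu (L h) := cL _ Mm.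
have L_dom : \forall h \near (0 : R), dominated_path L g h.
  have Mg0 : \forall h \near (0 : R), dominated_partials M g (th0 + h *: v) := cL _ Mg.
  apply: filterS Mg0 => h dh x; have [dc [de be] [df bf]] := dh j x.
  split.
  - move=> a y; have [dcay bcay] := dc a y.
    by rewrite (derivable_line (fun t => cdens (M t) a y x))
               (derive_line (fun t => cdens (M t) a y x)).
  - by rewrite (derivable_line (fun t => prop (M t) x))
               (derive_line (fun t => prop (M t) x)).
  - by rewrite (derivable_line (fun t => xdens (M t) x))
               (derive_line (fun t => xdens (M t) x)).
have partialE (F : 'rV[R]_k -> R) :
    partial F j th0 = 'D_1 (fun h : R => F (th0 + h *: v)) 0.
  by rewrite derive_line scale0r addr0.
pose dobs y a x := 'D_1 (fun t => obs_density (L t) y a x) 0.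
have scoreE y a : score M th0 j y a = fun x => dobs y a x / obs_density l0 y a x.
  by apply/funext => x; rewrite /score partialE M0.
have dobs_eq0 y a x : obs_density l0 y a x = 0 -> dobs y a x = 0.
  by move=> q0; apply: (derive_obs_density_eq0 L_model L_dom); rewrite L0.
have mdobs y a : measurable_fun [set: T] (dobs y a).
  exact: (measurable_derive_obs_density L_model L_dom).
have iw y a : nu.-integrable [set: T] (fun x => (w y a x * dobs y a x)%:E).
  have := @integrable_eif_derive _ _ _ _ L g L_model ig L_dom r mur mu1 mu1_neq0 y a.
  rewrite L0; apply; have := ps j; apply: eq_integrable => // x _.
  by rewrite /prop_score partialE M0.
have [ip pE] := integrable_psi (fun y a x f0 => dobs_eq0 y a x (obs0 y a f0)) mdobs iw.
have scoreM y a x : psi y a x * score M th0 j y a x * obs_density l0 y a x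
    = psi y a x * dobs y a x.
  rewrite scoreE -mulrA; congr (_ * _).
  (* Where the density vanishes both sides are 0, since its derivative vanishes there too. *)
  have [/[dup] q0 /dobs_eq0 ->|q0] := eqVneq (obs_density l0 y a x) 0.
    by rewrite !mul0r.
  by rewrite divfK.
have mh y a : measurable_fun [set: T] (fun x => psi y a x * score M th0 j y a x).
  apply: measurable_funM => //; rewrite scoreE; apply: measurable_funM => //.
  by apply: measurable_funV; exact: (measurable_obs_density y a l0_model).
have ih y a : nu.-integrable [set: T]
    (fun x => (psi y a x * score M th0 j y a x * obs_density l0 y a x)%:E).
  by rewrite (_ : (fun x => _) = (fun x => (psi y a x * dobs y a x)%:E))//;
    apply/funext => x; rewrite scoreM.
have [i1 E1] := integral_obs mh ih; split; first exact: i1.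
have [iD1 D1] := is_derive_integral_factors L_model ig L_dom true false.
have [iDr Dr] := is_derive_integral_factors L_model ig L_dom r true.
rewrite E1 /=; under eq_bigr do under eq_Rintegral do rewrite scoreM.
rewrite pE.
have DE x : \sum_(i : bool * bool) w i.1 i.2 x * dobs i.1 i.2 x =
    mur / mu1 ^+ 2 * 'D_1 (fun t => factors true false (L t) x) 0
    - mu1^-1 * 'D_1 (fun t => factors r true (L t) x) 0.
  by have := eif_derive_sum L_model L_dom r mur mu1_neq0 x; rewrite L0.
under eq_Rintegral do rewrite DE.
rewrite Rintegral_lin//.
apply: (@is_derive_line _ _ _ _ th0 v).
have mu1E : \int[nu]_x factors true false (L 0) x = mu1 by rewrite L0.
have murE : \int[nu]_x factors r true (L 0) x = mur by rewrite L0.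
have n0 : \int[nu]_x factors true false (L 0) x != 0 by rewrite mu1E.
(* The quotient rule at 0 gives mur / mu1^2 times the derivative of the denominator minus 1 / mu1
   times that of the numerator, the two coefficients found above. *)
have := is_deriveB (is_derive_cst (1 : R) (0 : R) 1)
  (is_deriveM Dr (is_deriveV n0 D1)).
move=> H; apply: (is_derive_eq H); rewrite mu1E murE /GRing.scale/=.
by field.
Qed.

(** [s1] and [s0] are [psi] at a = 1 and a = 0, centred at its conditional mean given A = a and X =
    x. *)
Let s1 (y : bool) (x : T) : R :=
  (mur / mu1 ^+ 2 - (if r then m false x / mu1 else 0)) * (y%:R - m true x).

Let s0 (y : bool) (x : T) : R :=
  - (prop l0 x / mu1 / (1 - prop l0 x) * (if r then m true x else 1)
     * (y%:R - m false x)).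

(** The conditional mean of the influence function given A = 1 and X = x; given A = 0 that mean is
    0. The regressions are arguments because the formula is used with [m] and with the conditional
    densities. *)
Let alpha_of (m0 m1 : T -> R) (x : T) : R :=
  mur / mu1 ^+ 2 * m1 x - m0 x * (if r then m1 x else 1) / mu1.

Let malpha m0 m1 : measurable_fun [set: T] m0 -> measurable_fun [set: T] m1 ->
  measurable_fun [set: T] (alpha_of m0 m1).
Proof.
move=> mm0 mm1; apply: measurable_funB; first exact: measurable_funM.
by apply: measurable_funM => //; apply: measurable_funM => //; case: r.
Qed.

Lemma eif_tangent : tangent_space P nu X l0 psi.
Proof.
have [[mc c0 cs] [me e01] _] := l0_model.
have [mf f0 _] := X_density.
pose alpha := alpha_of (m false) (m true).
pose alphac := alpha_of (cdens l0 false true) (cdens l0 true true).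
have ma : measurable_fun [set: T] alpha by exact: malpha.
have mac : measurable_fun [set: T] alphac by exact: malpha.
(* Transfers from [alphac] to [alpha] any expression that vanishes with the density of X. *)
have alphaE (F : T -> R -> R) : (forall x u, xdens l0 x = 0 -> F x u = 0) ->
    ae_eq nu [set: T] (fun x => (F x (alphac x))%:E) (fun x => (F x (alpha x))%:E).
  move=> F0; apply: filterS m_cdens => x + _ => -[/F0 h|mE]; first by rewrite !h.
  by rewrite /alpha /alphac /alpha_of !mE.
have alphac_e x : alphac x * prop l0 x * xdens l0 x =
    mur / mu1 ^+ 2 * factors true false l0 x - mu1^-1 * factors r true l0 x.
  by rewrite /alphac /alpha_of /factors; case: r; field.
have i1 := integrable_factors true false l0_model.
have i2 := integrable_factors r true l0_model.
have ise : nu.-integrable [set: T] (fun x => (alphac x * prop l0 x * xdens l0 x)%:E).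
  have i3 := integrableB measurableT (integrableZl measurableT (mur / mu1 ^+ 2) i1)
    (integrableZl measurableT mu1^-1 i2).
  by rewrite (_ : (fun x => _) = fun x => (mur / mu1 ^+ 2 * factors true false l0 x
    - mu1^-1 * factors r true l0 x)%:E)//; apply/funext => x; rewrite alphac_e.
have mse : measurable_fun [set: T] (fun x => (alpha x * prop l0 x * xdens l0 x)%:E).
  by apply/measurable_EFinP; apply: measurable_funM => //; exact: measurable_funM.
have aes : ae_eq nu [set: T] (fun x => (alphac x * prop l0 x * xdens l0 x)%:E)
    (fun x => (alpha x * prop l0 x * xdens l0 x)%:E).
  by apply: (alphaE (fun x u => u * prop l0 x * xdens l0 x)) => x u ->; rewrite mulr0.
(* The conditional mean given (A, X) is alpha a, which splits as alpha (a - e) + alpha e; the last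
   term is the component depending on x alone. *)
exists s1, s0, alpha, (fun x => alpha x * prop l0 x); split.
- move=> y; split.
    apply: measurable_funM; last exact: measurable_funB.
    apply: measurable_funB => //; case: r => //.
    exact: measurable_funM.
  apply: measurableT_comp => //; apply: measurable_funM; last exact: measurable_funB.
  apply: measurable_funM; last by case: r.
  apply: measurable_funM; first exact: measurable_funM.
  by apply: measurable_funV; exact: measurable_funB.
- apply: filterS (ae_of_density m_cdens) => u mE.
  have cF a : cdens l0 a false (X u) = 1 - cdens l0 a true (X u).
    by rewrite -(cs a (X u)) addrK.
  by rewrite !big_bool /s1 /s0 /= !cF !mE; split; case: r; ring.
- split.
  + exact: measurable_funM.
  + exact: integrable_ae_eq aes ise.
  + rewrite -(@ae_eq_integral _ _ _ _ _ _ _ measurableT (measurable_int _ ise) mse aes).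
    rewrite -[LHS]fineK; last exact: integrable_fin_num ise.
    congr EFin; rewrite -[LHS]/(\int[nu]_x _).
    under eq_Rintegral do rewrite alphac_e.
    by rewrite Rintegral_lin// -/mu1 -/mur; field.
- split=> //.
  (* [C] bounds [alphac] pointwise, so its square is integrable against the density of X. *)
  pose C : R := `|mur / mu1 ^+ 2| + `|mu1^-1|.
  have iC := integrableZl measurableT (C ^+ 2) (integrable_xdens l0_model).
  have ic : nu.-integrable [set: T] (fun x => (alphac x ^+ 2 * xdens l0 x)%:E).
    apply: (le_integrable _ _ _ iC) => //.
      by apply/measurable_EFinP; apply: measurable_funM => //; exact: measurable_funX.
    move=> x _; rewrite -EFinM lee_fin (normrM (alphac x ^+ 2)) (normrM (C ^+ 2)) ler_wpM2r// !normrX.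
    have /andP[a0 a1] := cdens_itv01 false true x l0_model.
    have /andP[b0 b1] := cdens_itv01 true true x l0_model.
    rewrite lerXn2r ?nnegrE// [leRHS]ger0_norm ?addr_ge0//.
    apply: le_trans (ler_normB _ _) _; apply: lerD.
      by rewrite normrM (ger0_norm b0) ler_piMr.
    rewrite normrM ler_piMl// normrM (ger0_norm a0) mulr_ile1//.
    by case: r; rewrite ?normr1// ger0_norm.
  apply: integrable_ae_eq ic.
    by apply/measurable_EFinP; apply: measurable_funM => //; exact: measurable_funX.
  by apply: (alphaE (fun x u => u ^+ 2 * xdens l0 x)) => x u ->; rewrite mulr0.
- move=> y a x; rewrite /psi /eif /s1 /s0 /alpha /alpha_of.
  have /andP[_ e1] := e01 x.
  have e1' : 1 - prop l0 x != 0 by rewrite gt_eqF// subr_gt0.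
  by case: r; case: a; case: y => /=; field; rewrite mu1_neq0 e1'.
Qed.

Lemma eif_efficient (beta : law R T -> R) :
  (forall l, beta l = 1 - (\int[nu]_x factors r true l x)
                          / (\int[nu]_x factors true false l x)) ->
  efficient_influence_function P nu Y A X l0 beta psi.
Proof.
move=> betaE; have [ip pE] := integral_eif; split; last exact: eif_tangent.
split=> //; first by rewrite unlock.
move=> k th0 M Mreg j; have [i1 D1] := eif_submodel Mreg j; split=> //.
rewrite (_ : (fun th => beta (M th)) = fun th => 1 - (\int[nu]_x factors r true (M th) x)
  / (\int[nu]_x factors true false (M th) x)); last by apply/funext => th.
by rewrite unlock.
Qed.

Lemma eif_variance :
  ('V_P[fun w => psi (Y w) (A w) (X w)] =
   'E_P[(fun w => psi (Y w) (A w) (X w) ^+ 2)%R])%E.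
Proof.
have [_ pE] := integral_eif.
(* The variance unfolds to the expectation of the squared centred function, so a zero mean suffices
   and the value may be infinite. *)
rewrite /variance unlock /=.
have -> : ('E_P[fun w => psi (Y w) (A w) (X w)] = 0)%E by rewrite unlock.
by congr ('E_P[_])%E; apply/funext => u;
  rewrite -[LHS]/((psi (Y u) (A u) (X u) - 0) * (psi (Y u) (A u) (X u) - 0)) subr0 expr2.
Qed.

End Influence.

(** * Identification *)

Section Identification.
Context (d dT : measure_display) (Omega : measurableType d)
  (T : measurableType dT) (R : realType) (P : probability Omega R)
  (nu : {sigma_finite_measure set T -> \bar R})
  (X : Omega -> T) (A Y Y0 Y1 : Omega -> bool) (l0 : law R T)
  (m : bool -> T -> R).
Hypotheses (mX : measurable_fun [set: Omega] X)
  (mA : measurable_fun [set: Omega] A)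
  (mY0 : measurable_fun [set: Omega] Y0)
  (mY1 : measurable_fun [set: Omega] Y1)
  (consistency : forall w : Omega,
     (Y w)%:R = (A w)%:R * (Y1 w)%:R + (1 - (A w)%:R) * (Y0 w)%:R :> R)
  (l0_true : is_true_law P nu X A Y0 Y1 l0)
  (m_regression : cond_prob P (fun w => (X w, A w)) (Y @^-1` [set true])
     (fun z => m z.2 z.1))
  (ignorability : cond_indep P X (fun w => (Y0 w, Y1 w)) A)
  (overlap : forall x, 0 < prop l0 x < 1).

Let X_density : is_density P nu X (xdens l0). Proof. by case: l0_true. Qed.

Let Ya a := if a then Y1 else Y0.

Lemma consistencyE w : Y w = Ya (A w) w.
Proof.
have := consistency w; rewrite /Ya.
by case: (A w); case: (Y w); case: (Y0 w); case: (Y1 w) => /=;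
  rewrite ?(mul1r, mul0r, mulr1, mulr0, subrr, subr0, add0r, addr0) => // /eqP;
  rewrite ?oner_eq0 // eq_sym oner_eq0.
Qed.

Let mpre (V : Omega -> bool) b : measurable_fun [set: Omega] V -> measurable (V @^-1` [set b]).
Proof. by move=> mV; rewrite -[X in measurable X]setTI; exact: mV. Qed.

Lemma true_law_model : model_law nu l0.
Proof.
have [[h10 h1s h1] [h00 h0s h0] [me _ _] [mf f0 fE]] := l0_true.
split; [split|split|split] => //.
- by move=> a y; case: a; [have [] := h1 y|have [] := h0 y].
- by case.
- by case.
- by rewrite -fE// preimage_setT probability_setT.
Qed.

Lemma potential_outcome_density a y :
  has_density P nu X (Ya a @^-1` [set y]) (fun x => cdens l0 a y x * xdens l0 x).
Proof.
have [[h10 h1s h1] [h00 h0s h0] _ _] := l0_true.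
by case: a; apply: cond_prob_has_density.
Qed.

Lemma treatment_density a :
  has_density P nu X (A @^-1` [set a])
    (fun x => (if a then prop l0 x else 1 - prop l0 x) * xdens l0 x).
Proof.
have [_ _ he _] := l0_true.
have h1 := cond_prob_has_density mX X_density he.
case: a => //.
rewrite (_ : A @^-1` [set false] = ~` (A @^-1` [set true])); last first.
  by apply/seteqP; split=> w /=; case: (A w).
rewrite (_ : (fun x => _) = fun x => xdens l0 x - prop l0 x * xdens l0 x).
  by apply: has_densityC => //; exact: mpre.
by apply/funext => x; rewrite mulrBl mul1r.
Qed.

(** Stated for joint events of (Y0, Y1): one coordinate gives the observed density, and the pair (0,
    1) is needed under conditional independence. *)
Lemma ignorable_density (C : set (bool * bool)) (k : T -> R) a :
  measurable C -> measurable_fun [set: T] k ->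
  has_density P nu X ((fun w => (Y0 w, Y1 w)) @^-1` C) (fun x => k x * xdens l0 x) ->
  has_density P nu X ((fun w => (Y0 w, Y1 w)) @^-1` C `&` A @^-1` [set a])
    (fun x => k x * (if a then prop l0 x else 1 - prop l0 x) * xdens l0 x).
Proof.
move=> mC mk hk; have [_ [me _] [mf _ _]] := true_law_model.
apply: (cond_indep_has_density mX X_density ignorability) => //.
  exact: treatment_density.
apply: measurable_funM => //; apply: measurable_funM => //.
by case: a => //; exact: measurable_funB.
Qed.

Let m_pred_outcome a y :
  measurable [set u : bool * bool | (if a then u.2 else u.1) = y].
Proof.
have mpair (g : bool * bool -> bool) : measurable_fun [set: bool * bool] g ->
    measurable [set u | g u = y].
  by move=> mg; rewrite -[X in measurable X]setTI; exact: (mg measurableT [set y]).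
by case: a; apply: mpair; [exact: measurable_snd|exact: measurable_fst].
Qed.

(** The indices [b] and [a] may differ: Y0 among the treated enters the identification under
    monotonicity. *)
Lemma potential_treated_density b y a :
  has_density P nu X [set w | Ya b w = y /\ A w = a]
    (fun x => cdens l0 b y x * (if a then prop l0 x else 1 - prop l0 x) * xdens l0 x).
Proof.
have [[mc _ _] _ _] := true_law_model.
have := @ignorable_density _ (cdens l0 b y) a (m_pred_outcome b y) (mc b y).
rewrite (_ : (fun w => _) @^-1` _ = Ya b @^-1` [set y]); last by case: b.
by apply; exact: potential_outcome_density.
Qed.

Lemma observed_density y a :
  has_density P nu X [set w | Y w = y /\ A w = a] (obs_density l0 y a).
Proof.
rewrite (_ : [set w | _] = [set w | Ya a w = y /\ A w = a]); last first.
  by apply/seteqP; split=> w /=; rewrite consistencyE => -[+ aE]; rewrite aE.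
rewrite (_ : obs_density l0 y a = fun x => cdens l0 a y x *
    (if a then prop l0 x else 1 - prop l0 x) * xdens l0 x).
  exact: potential_treated_density.
by apply/funext => x; rewrite obs_densityE.
Qed.

Lemma measurable_observed y a : measurable [set w | Y w = y /\ A w = a].
Proof.
rewrite (_ : [set w | _] = Ya a @^-1` [set y] `&` A @^-1` [set a]); last first.
  by apply/seteqP; split=> w /=; rewrite consistencyE => -[+ aE]; rewrite aE.
by apply: measurableI; apply: mpre => //; case: a.
Qed.

Lemma measurable_regression a : measurable_fun [set: T] (m a).
Proof.
have [mm _ _] := m_regression.
exact: (measurableT_comp mm (pair2_measurable a)).
Qed.

(** For each arm a, with e_a(x) = P(A = a | X = x), both m_a e_a f and f_a(1 | x) e_a f are
    densities of the event Y = 1, A = a, hence equal almost everywhere; overlap allows cancelling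
    e_a f wherever f is nonzero. *)
Lemma regression_cdens :
  {ae nu, forall x, xdens l0 x = 0 \/ forall a, m a x = cdens l0 a true x}.
Proof.
have [mm im mE] := m_regression.
have f0 : forall x, 0 <= xdens l0 x by case: X_density.
have ma a : {ae nu, forall x, xdens l0 x = 0 \/ m a x = cdens l0 a true x}.
  pose ea x := if a then prop l0 x else 1 - prop l0 x.
  have ea_gt0 x : 0 < ea x.
    by rewrite /ea; case/andP: (overlap x) => e0 e1; case: ifP; rewrite ?subr_gt0.
  have [iA A_density] := treatment_density a.
  have mqA : measurable_fun [set: T] (fun x => ea x * xdens l0 x).
    by apply/measurable_EFinP; exact: measurable_int iA.
  have q0 x : 0 <= ea x * xdens l0 x by rewrite mulr_ge0// ltW.
  have mAa : measurable (A @^-1` [set a]) by exact: mpre.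
  have iP : P.-integrable (A @^-1` [set a]) (EFin \o m a \o X).
    apply: (@eq_integrable _ _ _ _ _ mAa (fun w => (m (A w) (X w))%:E)).
      by move=> w /set_mem /= ->.
    exact: integrableS im.
  have im' : nu.-integrable [set: T] (fun x => (m a x * (ea x * xdens l0 x))%:E).
    apply/(integrable_density (P := P) (X := X) (E := A @^-1` [set a])) => //.
    exact: measurable_regression.
  have hm : has_density P nu X [set w | Y w = true /\ A w = a]
      (fun x => m a x * (ea x * xdens l0 x)).
    split=> // B mB.
    rewrite -(integral_has_density mX mAa q0 (treatment_density a))//; last first.
      exact: measurable_regression.
    (* Testing the regression on product sets with second factor {a} isolates one arm. *)
    have mBa : measurable (B `*` [set a]) by exact: measurableX.
    have := mE _ mBa.
    rewrite (_ : (fun w => (X w, A w)) @^-1` (B `*` [set a]) =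
        A @^-1` [set a] `&` X @^-1` B); last first.
      by apply/seteqP; split=> w /= [].
    rewrite setIA => EE.
    rewrite [LHS](_ : _ = P (Y @^-1` [set true] `&` A @^-1` [set a] `&` X @^-1` B))//.
    by rewrite -EE; apply: eq_integral => w /set_mem[/= ->].
  apply: filterS (has_density_unique hm (observed_density true a)) => x.
  rewrite obs_densityE -/(ea x) => E; have [->|fx0] := eqVneq (xdens l0 x) 0; [by left|right].
  have q_neq0 : ea x * xdens l0 x != 0 by rewrite mulf_neq0// gt_eqF.
  by apply: (mulIf q_neq0); rewrite E mulrA.
apply: filterS2 (ma true) (ma false) => x [->|h1] [h0|h0]; try by left.
by right; case.
Qed.

(** Identifies the constants, expectations under [P], with the functionals evaluated at the true
    law. *)
Lemma integral_m_factors r1 r0 :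
  (\int[P]_w ((if r1 then m true (X w) else 1) * (if r0 then m false (X w) else 1)
      * prop l0 (X w))%:E = (\int[nu]_x factors r1 r0 l0 x)%:E)%E.
Proof.
have l0_model := true_law_model.
have [_ [me _] [mf f0 _]] := l0_model.
have mite (b : bool) (k : T -> R) : measurable_fun [set: T] k ->
    measurable_fun [set: T] (fun x => if b then k x else 1) by case: b.
pose h x := (if r1 then m true x else 1) * (if r0 then m false x else 1) * prop l0 x.
have mh : measurable_fun [set: T] h.
  apply: measurable_funM => //.
  by apply: measurable_funM; apply: mite; exact: measurable_regression.
have ifac := integrable_factors r1 r0 l0_model.
have mhf : measurable_fun [set: T] (fun x => (h x * xdens l0 x)%:E).
  by apply/measurable_EFinP; exact: measurable_funM.
have ae : ae_eq nu [set: T] (EFin \o factors r1 r0 l0) (fun x => (h x * xdens l0 x)%:E).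
  apply: filterS regression_cdens => x + _ => -[f0x|mE].
    by rewrite /= /factors f0x !mulr0.
  by rewrite /= /factors /h !mE.
have ih := integrable_ae_eq mhf ae ifac.
have [_ fE] := is_density_has_density X_density.
rewrite -[LHS]/(\int[P]_(w in [set: Omega]) (h (X w))%:E)%E.
rewrite (integral_density (nu := nu) (q := xdens l0))//.
rewrite -(@ae_eq_integral _ _ _ _ _ _ _ measurableT (measurable_int _ ifac) mhf ae).
by rewrite fineK//; exact: integrable_fin_num ifac.
Qed.

Lemma prob_treated_case :
  P [set w | A w = true /\ Y w = true] = (\int[nu]_x factors true false l0 x)%:E.
Proof.
have [i1 E1] := observed_density true true.
have := E1 _ measurableT; rewrite preimage_setT setIT => E.
rewrite (_ : [set w | _] = [set w | Y w = true /\ A w = true]); last first.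
  by apply/seteqP; split=> w /= [].
rewrite E fineK; last exact: integrable_fin_num (integrable_factors _ _ true_law_model).
by apply: eq_integral => x _; rewrite obs_densityE /factors mulr1.
Qed.

(** Under monotonicity a treated unit with Y0 = 1 almost surely has Y = 1, so the probability sought
    is P(A = 1, Y = 1) - P(Y0 = 1, A = 1). *)
Lemma prob_necessity_mono : {ae P, forall w, (Y0 w <= Y1 w)%N} ->
  P [set w | Y0 w = false /\ A w = true /\ Y w = true] =
  (\int[nu]_x factors true false l0 x - \int[nu]_x factors false true l0 x)%:E.
Proof.
move=> mono.
have [i1 E1] := potential_treated_density false true true.
have := E1 _ measurableT; rewrite preimage_setT setIT => E.
have E2 : P [set w | Y0 w = true /\ A w = true] = (\int[nu]_x factors false true l0 x)%:E.
  rewrite -[LHS]/(P [set w | Ya false w = true /\ A w = true]) E fineK.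
    by apply: eq_integral => x _; rewrite /factors mul1r.
  exact: integrable_fin_num (integrable_factors _ _ true_law_model).
pose S y0 y := [set w | Y0 w = y0 /\ (Y w = y /\ A w = true)].
have mS y0 y : measurable (S y0 y).
  exact: (measurableI _ _ (mpre y0 mY0) (measurable_observed y true)).
(* Among the treated Y is Y1, so this event violates monotonicity. *)
have S10 : P (S true false) = 0%E.
  apply: measure_negligible => //; apply: negligibleS mono => w [Y0w [+ Aw]] /=.
  rewrite consistencyE Aw /= => Y1w.
  by rewrite Y0w Y1w.
have SY0 : P [set w | Y0 w = true /\ A w = true] = P (S true true).
  rewrite (_ : [set w | _] = S true true `|` S true false).
    rewrite measureU//; first by rewrite [X in (_ + X)%E]S10 adde0.
    by apply/seteqP; split=> w // [[_ [Yt _]] [_ [Yf _]]]; rewrite Yt in Yf.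
  apply/seteqP; split=> w; last by case=> -[? [_ ?]].
  by case=> Y0w Aw; case Yw: (Y w); [left|right].
have SY1 : P [set w | A w = true /\ Y w = true] = (P (S false true) + P (S true true))%E.
  rewrite (_ : [set w | _] = S false true `|` S true true).
    rewrite measureU//.
    by apply/seteqP; split=> w // [[Y0f _] [Y0t _]]; rewrite Y0f in Y0t.
  apply/seteqP; split=> w; last by case=> -[_ [? ?]].
  by case=> Aw Yw; case Y0w: (Y0 w); [right|left].
rewrite EFinB -prob_treated_case -E2 SY0 SY1 addeK; last exact: fin_num_measure.
by congr (P _); apply/seteqP; split=> w [? [? ?]].
Qed.

(** By consistency the event is (Y0, Y1) = (0, 1) with A = 1, whose density is (1 - mu_0) mu_1 e f
    by the two independence assumptions. *)
Lemma prob_necessity_ci : cond_indep P X Y0 Y1 ->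
  P [set w | Y0 w = false /\ A w = true /\ Y w = true] =
  (\int[nu]_x factors true false l0 x - \int[nu]_x factors true true l0 x)%:E.
Proof.
move=> ci; have l0_model := true_law_model.
have [[mc _ cs] [me _] [mf f0 _]] := l0_model.
have h01 : has_density P nu X ((fun w => (Y0 w, Y1 w)) @^-1` [set (false, true)])
    (fun x => (cdens l0 false false x * cdens l0 true true x) * xdens l0 x).
  rewrite (_ : _ @^-1` _ = Y0 @^-1` [set false] `&` Y1 @^-1` [set true]); last first.
    by apply/seteqP; split=> w /= [-> ->].
  apply: (cond_indep_has_density mX X_density ci) => //.
  - exact: (potential_outcome_density false false).
  - exact: (potential_outcome_density true true).
  - by apply: measurable_funM => //; exact: measurable_funM.
have m01 : measurable [set (false, true)].
  rewrite (_ : [set _] = [set false] `*` [set true]); first exact: measurableX.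
  by apply/seteqP; split=> -[a b] /= [-> ->].
have mk : measurable_fun [set: T] (fun x => cdens l0 false false x * cdens l0 true true x).
  exact: measurable_funM.
have [_ E] := ignorable_density true m01 mk h01.
have := E _ measurableT; rewrite preimage_setT setIT => {}E.
rewrite (_ : [set w | _] = (fun w => (Y0 w, Y1 w)) @^-1` [set (false, true)]
   `&` A @^-1` [set true]); last first.
  apply/seteqP; split=> w /=; rewrite consistencyE.
    by case=> -> [-> /= ->].
  by case=> -[-> +] -> /= => ->.
rewrite E -RintegralB//; try exact: integrable_factors.
rewrite fineK; last first.
  apply: integrable_fin_num => //.
  exact: (integrableB measurableT (integrable_factors true false l0_model)
    (integrable_factors true true l0_model)).
apply: eq_integral => x _; congr EFin; rewrite /factors.
have -> : cdens l0 false false x = 1 - cdens l0 false true x by rewrite -(cs false x) addrK.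
by ring.
Qed.

End Identification.

(** * Reduction of the stated formulas to the common one *)

Lemma mu_law_false (d : measure_display) (T : measurableType d) (R : realType)
    (nu : {sigma_finite_measure set T -> \bar R}) (l : law R T) :
  mu_law nu l false = \int[nu]_x factors false true l x.
Proof. by apply: eq_Rintegral => x _; rewrite /factors mul1r. Qed.

Lemma mu_law_true (d : measure_display) (T : measurableType d) (R : realType)
    (nu : {sigma_finite_measure set T -> \bar R}) (l : law R T) :
  mu_law nu l true = \int[nu]_x factors true false l x.
Proof. by apply: eq_Rintegral => x _; rewrite /factors mulr1. Qed.

Lemma phi_beta_eif (d : measure_display) (T : measurableType d) (R : realType)
    (mu0 mu1 : R) (e m0 m1 : T -> R) : mu1 != 0 -> (forall x, 0 < e x < 1) ->
  phi_beta mu0 mu1 e m0 m1 = eif false mu0 mu1 e m0 m1.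
Proof.
move=> mu1_neq0 e01; apply/funext => y; apply/funext => a; apply/funext => x.
have e1_neq0 : 1 - e x != 0 by case/andP: (e01 x) => _ e1; rewrite gt_eqF// subr_gt0.
by rewrite /phi_beta /eif; field; rewrite mu1_neq0 e1_neq0.
Qed.

Lemma varphi_beta_eif (d : measure_display) (T : measurableType d) (R : realType)
    (mu mu1 : R) (e m0 m1 : T -> R) : mu1 != 0 -> (forall x, 0 < e x < 1) ->
  varphi_beta mu mu1 e m0 m1 = eif true mu mu1 e m0 m1.
Proof.
move=> mu1_neq0 e01; apply/funext => y; apply/funext => a; apply/funext => x.
have e1_neq0 : 1 - e x != 0 by case/andP: (e01 x) => _ e1; rewrite gt_eqF// subr_gt0.
by rewrite /varphi_beta /eif; field; rewrite mu1_neq0 e1_neq0.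
Qed.

Theorem theorem1 (R : realType) (d : measure_display) (Omega : measurableType d)
    (P : probability Omega R) (p : nat)
    (nu : {sigma_finite_measure set (p.-tuple R) -> \bar R})
    (X : Omega -> p.-tuple R) (A Y Y0 Y1 : Omega -> bool)
    (mX : measurable_fun [set: Omega] X)
    (mA : measurable_fun [set: Omega] A)
    (mY0 : measurable_fun [set: Omega] Y0)
    (mY1 : measurable_fun [set: Omega] Y1)
    (consistency : forall w : Omega,
       (Y w)%:R = (A w)%:R * (Y1 w)%:R + (1 - (A w)%:R) * (Y0 w)%:R :> R)
    (law0 : law R (p.-tuple R))
    (Hlaw0 : is_true_law P nu X A Y0 Y1 law0)
    (m : bool -> p.-tuple R -> R)
    (Hm : cond_prob P (fun w => (X w, A w)) (Y @^-1` [set true])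
            (fun z => m z.2 z.1))
    (HAY : (0 < P [set w | A w = true /\ Y w = true])%E)
    (ignorability : cond_indep P X (fun w => (Y0 w, Y1 w)) A)
    (overlap : forall x : p.-tuple R, 0 < prop law0 x < 1) :
  let e := prop law0 in
  let mu0 : R := fine 'E_P[(fun w => m false (X w) * e (X w))%R]%E in
  let mu1 : R := fine 'E_P[(fun w => m true (X w) * e (X w))%R]%E in
  let mu : R := fine 'E_P[(fun w => m true (X w) * m false (X w) * e (X w))%R]%E in
  let beta : R := prob_necessary_causation P Y0 Y A in
  let phi := phi_beta mu0 mu1 e (m false) (m true) in
  let varphi := varphi_beta mu mu1 e (m false) (m true) in
  ({ae P, forall w : Omega, (Y0 w <= Y1 w)%N} ->
     [/\ beta = 1 - mu0 / mu1,
         efficient_influence_function P nu Y A X law0 (beta_mono nu) phi,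
         forall (y a : bool) (x : p.-tuple R),
           phi y a x =
             (1 - beta) / mu1 * a%:R * y%:R
             - e x / mu1 * ((1 - a%:R) / (1 - e x)) * (y%:R - m false x)
             - m false x / mu1 * a%:R,
         efficiency_bound P nu Y A X law0 (beta_mono nu)
           'V_P[fun w => phi (Y w) (A w) (X w)]%E &
         'V_P[fun w => phi (Y w) (A w) (X w)]%E
           = 'E_P[(fun w => phi (Y w) (A w) (X w) ^+ 2)%R]%E])
  /\
  (cond_indep P X Y0 Y1 ->
     [/\ beta = 1 - mu / mu1,
         efficient_influence_function P nu Y A X law0 (beta_ci nu) varphi,
         forall (y a : bool) (x : p.-tuple R),
           varphi y a x =
             a%:R * ((1 - beta - m false x) / mu1) * y%:R
             - e x / mu1 * ((1 - a%:R) / (1 - e x)) * (y%:R - m false x)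
               * m true x,
         efficiency_bound P nu Y A X law0 (beta_ci nu)
           'V_P[fun w => varphi (Y w) (A w) (X w)]%E &
         'V_P[fun w => varphi (Y w) (A w) (X w)]%E
           = 'E_P[(fun w => varphi (Y w) (A w) (X w) ^+ 2)%R]%E]).
Proof.
move=> e mu0 mu1 mu beta phi varphi.
pose F r1 r0 := \int[nu]_x factors r1 r0 law0 x.
have l0_model := true_law_model Hlaw0 overlap.
have X_density : is_density P nu X (xdens law0) by case: Hlaw0.
have mm := measurable_regression Hm.
have mYA := measurable_observed mA mY0 mY1 consistency.
have YA_density := observed_density mX mA consistency Hlaw0 ignorability overlap.
have m_cdens := regression_cdens mX mA consistency Hlaw0 Hm ignorability overlap.
have mE := integral_m_factors mX mA consistency Hlaw0 Hm ignorability overlap.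
have PAY := prob_treated_case mX mA consistency Hlaw0 ignorability overlap.
have mu0E : mu0 = F false true.
  rewrite /mu0 unlock -[RHS]/(fine (F false true)%:E) -(mE false true).
  by congr fine; apply: eq_integral => w _; rewrite /= mul1r.
have mu1E : mu1 = F true false.
  rewrite /mu1 unlock -[RHS]/(fine (F true false)%:E) -(mE true false).
  by congr fine; apply: eq_integral => w _; rewrite /= mulr1.
have muE : mu = F true true.
  by rewrite /mu unlock -[RHS]/(fine (F true true)%:E) -(mE true true).
(* Positivity of P(A = 1, Y = 1), which equals the constant mu_1, licenses all divisions by it. *)
have F_neq0 : F true false != 0.
  by move: HAY; rewrite PAY lte_fin => /gt_eqF ->.
have mu1_neq0 : mu1 != 0 by rewrite mu1E.
have e1_neq0 x : 1 - e x != 0.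
  by case/andP: (overlap x) => _ e1; rewrite gt_eqF// subr_gt0.
(* The exponent [r] stays free here: false serves part (a) and true part (b). *)
have eff r := @eif_efficient _ _ _ _ _ P nu X Y A law0 mX mYA l0_model X_density
  YA_density r m mm m_cdens F_neq0.
have var r := @eif_variance _ _ _ _ _ P nu X Y A law0 mX mYA l0_model
  YA_density r m mm m_cdens F_neq0.
split=> [mono|ci].
- have betaE : beta = 1 - mu0 / mu1.
    rewrite /beta /prob_necessary_causation PAY.
    rewrite (prob_necessity_mono mX mA mY0 mY1 consistency Hlaw0 ignorability overlap mono).
    by rewrite /= mulrBl mu0E mu1E divff.
  have phiE : phi = eif false (F false true) (F true false) e (m false) (m true).
    by rewrite /phi mu0E mu1E phi_beta_eif.
  have effP : efficient_influence_function P nu Y A X law0 (beta_mono nu) phi.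
    by rewrite phiE; apply: eff => l; rewrite /beta_mono mu_law_false mu_law_true.
  split=> //.
  + move=> y a x; rewrite betaE /phi /phi_beta.
    by field; rewrite mu1_neq0 e1_neq0.
  + by exists phi.
  + by rewrite phiE; exact: var.
- have betaE : beta = 1 - mu / mu1.
    rewrite /beta /prob_necessary_causation PAY.
    rewrite (prob_necessity_ci mX mA consistency Hlaw0 ignorability overlap ci).
    by rewrite /= mulrBl muE mu1E divff.
  have varphiE : varphi = eif true (F true true) (F true false) e (m false) (m true).
    by rewrite /varphi muE mu1E varphi_beta_eif.
  have effP : efficient_influence_function P nu Y A X law0 (beta_ci nu) varphi.
    by rewrite varphiE; apply: eff => l; rewrite /beta_ci mu_law_true.
  split=> //.
  + move=> y a x; rewrite betaE /varphi /varphi_beta.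
    by field; rewrite mu1_neq0 e1_neq0.
  + by exists varphi.
  + by rewrite varphiE; exact: var.
Qed.
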